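(* Let $n\ge2$, let $\lambda$ be a quadratic form on $\mathbb{R}^{n+1}$ restricted to the unit sphere $\mathbb{S}^n\subset\mathbb{R}^{n+1}$, and let $\sigma=\tfrac12\operatorname{grad}^{\mathbb{S}^n}\lambda$ be its associated vector field. If $n$ is even, then $\sigma$ can never be a harmonic section from $(\mathbb{S}^n,g_{\mathrm{can}})$ into $T\mathbb{S}^n$ equipped with a Kaluza-Klein metric with $A\equiv1$. If $n$ is odd, then $\sigma$ is a harmonic section for some Kaluza-Klein metric on $T\mathbb{S}^n$ with $A\equiv 1$ if and only if $\lambda$ has exactly two distinct eigenvalues $a_1>a_2$, of multiplicity $\frac{n+1}{2}$, and $n>3$. In this case, setting $\mu=a_1-a_2$, possible choices for the Kaluza-Klein metric (with $A\equiv 1$) are: - for $n=5$: $C=0$ and $B(t)=Ke^{-8t/\mu^2}$ ($K>0$); - for $n>5$: $C=0$ and (a prolongation of) $$B(t)=K\left[\tfrac{n-3}{2}\mu^2-(n-5)t\right]^{\frac{n+3}{n-5}}\quad(K>0),\qquad t\in[0,\tfrac{\mu^2}{4}].$$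
   Context: Let $(M,g)$ be a Riemannian manifold with Levi-Civita connection $\nabla$. At $(p,e)\in TM$ the space $T_{(p,e)}TM$ splits into the vertical space (kernel of $d\pi$, $\pi:TM\to M$ the projection) and the horizontal space defined by $\nabla$; each $X\in T_pM$ has a horizontal lift $X^h$ and a vertical lift $X^v$. A Kaluza-Klein metric on $TM$ is a Riemannian metric $G$ such that at $(p,e)$ $$G(X^h,Y^h)=A(|e|^2)g(X,Y),\quad G(X^h,Y^v)=0,\quad G(X^v,Y^v)=B(|e|^2)g(X,Y)+C(|e|^2)g(X,e)g(Y,e),$$ where $A,B,C$ are real $C^2$ functions of $|e|^2$, $A>0$, and $B,C$ are such that $G$ is positive definite. A ''prolongation'' of a positive function $B$ given on an interval $[0,t_0]$ is an extension of it beyond that interval that keeps it strictly positive. A vector field $\sigma$ on $M$ is viewed as a map $\sigma:(M,g)\to(TM,G)$. Its tension field $\tau(\sigma)=\operatorname{trace}\nabla d\sigma$ (computed with the Levi-Civita connections of $g$ and $G$) is decomposed as $\tau(\sigma)=[\tau^h(\sigma)]^h+[\tau^v(\sigma)]^v$ with $\tau^h(\sigma),\tau^v(\sigma)$ vector fields on $M$. $\sigma$ is a harmonic section if $\tau^v(\sigma)=0$ (equivalently, when $A\equiv1$, it is critical for the energy with respect to variations through vector fields). $g_{\mathrm{can}}$ is the canonical round metric. The eigenvalues of the quadratic form $\lambda$ are those of the symmetric matrix $S$ with $\lambda(x)=\langle Sx,x\rangle$.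
   Formalization: The quadratic form λ is assumed nonconstant on the sphere, i.e. σ is not identically zero; for constant λ the zero field is a harmonic section for every Kaluza-Klein metric, so the claim as written fails. *)

(* Defs.v *)
From HB Require Import structures.
From mathcomp Require Import all_boot all_order all_algebra.
From mathcomp Require Import all_classical all_reals all_analysis.

Set Implicit Arguments.
Unset Strict Implicit.
Unset Printing Implicit Defensive.

Import Order.TTheory GRing.Theory Num.Theory.
Import numFieldNormedType.Exports.

Local Open Scope classical_set_scope.
Local Open Scope ring_scope.

(* Riemannian geometry is done in local coordinates: a metric on a coordinate
   domain R^m is its Gram matrix g : 'rV_m -> 'M_m in the frame d/dx_i. *)

Section LocalCoordinates.
Context {R : realType}.

Definition ip m (M : 'M[R]_m) (u v : 'rV[R]_m) : R := (u *m M *m v^T) 0 0.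

Definition posdef m (M : 'M[R]_m) : Prop :=
  forall u : 'rV[R]_m, u != 0 -> 0 < ip M u u.

Definition partial m (i : 'I_m) (f : 'rV[R]_m -> R) (x : 'rV[R]_m) : R :=
  'D_(delta_mx 0 i) f x.

(* christoffel g k i j = Gamma^k_{ij} *)
Definition christoffel m (g : 'rV[R]_m -> 'M[R]_m) (k i j : 'I_m)
    (x : 'rV[R]_m) : R :=
  2^-1 * \sum_l invmx (g x) k l *
    (partial i (fun y => g y j l) x + partial j (fun y => g y i l) x
     - partial l (fun y => g y i j) x).

Definition gradient m (g : 'rV[R]_m -> 'M[R]_m) (f : 'rV[R]_m -> R)
    (x : 'rV[R]_m) : 'rV[R]_m :=
  \row_i \sum_j invmx (g x) i j * partial j f x.

(* trace_g (nabla dF) for F : (R^m, g) -> (R^k, h), with nabla induced by the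
   Levi-Civita connections of g and h *)
Definition tension m k (g : 'rV[R]_m -> 'M[R]_m) (h : 'rV[R]_k -> 'M[R]_k)
    (F : 'rV[R]_m -> 'rV[R]_k) (x : 'rV[R]_m) : 'rV[R]_k :=
  let dF i a := partial i (fun y => F y 0 a) in
  \row_a \sum_i \sum_j invmx (g x) i j *
    (partial i (dF j a) x
     - \sum_l christoffel g l i j x * dF l a x
     + \sum_b \sum_c christoffel h a b c (F x) * dF i b x * dF j c x).

(* The tangent bundle of R^m has coordinates z = (x, e) = row_mx x e, and a
   tangent vector at z has components w = row_mx X W. *)

(* the correction term Gamma^k_{ij} X^i e^j *)
Definition christoffel_app m (g : 'rV[R]_m -> 'M[R]_m) (x X e : 'rV[R]_m) :
    'rV[R]_m :=
  \row_k \sum_i \sum_j christoffel g k i j x * X 0 i * e 0 j.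

Definition hlift m (g : 'rV[R]_m -> 'M[R]_m) (z : 'rV[R]_(m + m))
    (X : 'rV[R]_m) : 'rV[R]_(m + m) :=
  row_mx X (- christoffel_app g (lsubmx z) X (rsubmx z)).

Definition vlift m (X : 'rV[R]_m) : 'rV[R]_(m + m) := row_mx 0 X.

(* hpart and vpart are the vectors X, Y such that w = X^h + Y^v; see
   lift_decomposition. *)
Definition hpart m (w : 'rV[R]_(m + m)) : 'rV[R]_m := lsubmx w.

Definition vpart m (g : 'rV[R]_m -> 'M[R]_m) (z w : 'rV[R]_(m + m)) :
    'rV[R]_m :=
  rsubmx w + christoffel_app g (lsubmx z) (lsubmx w) (rsubmx z).

Definition kk_form m (g : 'rV[R]_m -> 'M[R]_m) (A B C : R -> R)
    (z w w' : 'rV[R]_(m + m)) : R :=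
  let gx := g (lsubmx z) in
  let e := rsubmx z in
  let t := ip gx e e in
  A t * ip gx (hpart w) (hpart w')
  + B t * ip gx (vpart g z w) (vpart g z w')
  + C t * ip gx (vpart g z w) e * ip gx (vpart g z w') e.

Definition kk_metric m (g : 'rV[R]_m -> 'M[R]_m) (A B C : R -> R)
    (z : 'rV[R]_(m + m)) : 'M[R]_(m + m) :=
  \matrix_(a, b) kk_form g A B C z (delta_mx 0 a) (delta_mx 0 b).

Lemma lift_decomposition m (g : 'rV[R]_m -> 'M[R]_m) (z w : 'rV[R]_(m + m)) :
  w = hlift g z (hpart w) + vlift (vpart g z w).
Proof.
by rewrite /hlift /vlift /hpart /vpart add_row_mx addr0 [X in row_mx _ X]addrC
  addrK hsubmxK.
Qed.

Lemma hpart_hlift m (g : 'rV[R]_m -> 'M[R]_m) (z : 'rV[R]_(m + m)) X :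
  hpart (hlift g z X) = X.
Proof. exact: row_mxKl. Qed.

Lemma vpart_hlift m (g : 'rV[R]_m -> 'M[R]_m) (z : 'rV[R]_(m + m)) X :
  vpart g z (hlift g z X) = 0.
Proof. by rewrite /vpart /hlift row_mxKl row_mxKr addNr. Qed.

Lemma hpart_vlift m (X : 'rV[R]_m) : hpart (vlift X) = 0.
Proof. exact: row_mxKl. Qed.

Lemma vpart_vlift m (g : 'rV[R]_m -> 'M[R]_m) (z : 'rV[R]_(m + m)) X :
  vpart g z (vlift X) = X.
Proof.
rewrite /vpart /vlift row_mxKl row_mxKr -[RHS]addr0; congr (_ + _).
apply/rowP => k; rewrite !mxE big1 // => i _; rewrite big1 // => j _.
by rewrite mxE mulr0 mul0r.
Qed.

Lemma ip0l m (M : 'M[R]_m) v : ip M 0 v = 0.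
Proof. by rewrite /ip !mul0mx mxE. Qed.

Lemma ip0r m (M : 'M[R]_m) u : ip M u 0 = 0.
Proof. by rewrite /ip trmx0 mulmx0 mxE. Qed.

Lemma kk_form_lifts m (g : 'rV[R]_m -> 'M[R]_m) (A B C : R -> R)
    (z : 'rV[R]_(m + m)) (X Y : 'rV[R]_m) :
  let gx := g (lsubmx z) in
  let e := rsubmx z in
  let t := ip gx e e in
  [/\ kk_form g A B C z (hlift g z X) (hlift g z Y) = A t * ip gx X Y,
      kk_form g A B C z (hlift g z X) (vlift Y) = 0 &
      kk_form g A B C z (vlift X) (vlift Y)
        = B t * ip gx X Y + C t * ip gx X e * ip gx Y e].
Proof.
by split; rewrite /kk_form ?hpart_hlift ?vpart_hlift ?hpart_vlift ?vpart_vlift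
  ?(ip0l, ip0r) ?(mulr0, mul0r) ?(addr0, add0r).
Qed.

(* The radial functions of a Kaluza-Klein metric live on [0, +oo[; a function
   that is C^2 up to the endpoint 0 is the restriction of a C^2 function on R,
   and only its values at t >= 0 are ever used. *)
Definition C2 (f : R -> R) : Prop :=
  [/\ forall t, derivable f t 1,
      forall t, derivable (f^`()%classic) t 1 &
      continuous (f^`(2)%classic)].

(* B prolongs beyond [0, T] a positive function B0 given on [0, T] *)
Definition prolongation (T : R) (B0 B : R -> R) : Prop :=
  [/\ C2 B,
      forall t, 0 <= t <= T -> B t = B0 t &
      forall t, 0 <= t -> 0 < B t].

End LocalCoordinates.

(* The sphere S^n in R^(n+1) is covered by the inverse stereographic
   projections chart Q : R^n -> S^n, one for each orthogonal matrix Q: chart Q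
   sends 0 to the first row of Q and misses only the antipode of that point. *)

Section Sphere.
Context {R : realType} (n : nat).

Definition dot m (u v : 'rV[R]_m) : R := (u *m v^T) 0 0.

Definition orthogonal_mx (Q : 'M[R]_n.+1) : Prop := Q *m Q^T = 1%:M.

Definition stereo (x : 'rV[R]_n) : 'rV[R]_n.+1 :=
  (1 + dot x x)^-1 *: row_mx (1 - dot x x)%:M (2 *: x).

Definition chart (Q : 'M[R]_n.+1) (x : 'rV[R]_n) : 'rV[R]_n.+1 :=
  stereo x *m Q.

(* pullback of the Euclidean metric of R^(n+1) by chart Q *)
Definition round_metric (Q : 'M[R]_n.+1) (x : 'rV[R]_n) : 'M[R]_n :=
  \matrix_(i, j) \sum_k partial i (fun y => chart Q y 0 k) x *
                        partial j (fun y => chart Q y 0 k) x.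

Definition quad (S : 'M[R]_n.+1) (p : 'rV[R]_n.+1) : R := dot (p *m S) p.

(* sigma = 1/2 grad lambda in the coordinates of chart Q *)
Definition quad_field (S Q : 'M[R]_n.+1) (x : 'rV[R]_n) : 'rV[R]_n :=
  2^-1 *: gradient (round_metric Q) (fun y => quad S (chart Q y)) x.

(* the map sigma : S^n -> TS^n, in the coordinates of chart Q *)
Definition quad_section (S Q : 'M[R]_n.+1) (x : 'rV[R]_n) : 'rV[R]_(n + n) :=
  row_mx x (quad_field S Q x).

Definition kaluza_klein (A B C : R -> R) : Prop :=
  [/\ C2 A, C2 B, C2 C,
      forall t, 0 <= t -> 0 < A t &
      forall Q, orthogonal_mx Q ->
      forall z, posdef (kk_metric (round_metric Q) A B C z)].

Definition harmonic_section (S : 'M[R]_n.+1) (A B C : R -> R) : Prop :=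
  forall Q, orthogonal_mx Q -> forall x,
    let g := round_metric Q in
    vpart g (quad_section S Q x)
      (tension g (kk_metric g A B C) (quad_section S Q) x) = 0.

(* the eigenvalues of S are exactly a1 > a2, both of multiplicity (n+1)/2;
   only meaningful for n odd *)
Definition two_eigenvalues (S : 'M[R]_n.+1) (a1 a2 : R) : Prop :=
  [/\ a2 < a1,
      forall a, eigenvalue S a = (a == a1) || (a == a2),
      \rank (eigenspace S a1) = n.+1./2 &
      \rank (eigenspace S a2) = n.+1./2].

End Sphere.

(* Main.v *)
(* Since A = 1, the vertical part of the tension field of sigma = 1/2 grad lambda,
   with its index lowered by the fibre metric and raised again by g, is
     B Lap(sigma) + 2 B' nabla_(grad F) sigma
       + [C <Lap(sigma), sigma> + C' |grad F|^2 + (C - B') |nabla sigma|^2] sigma,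
   where F = |sigma|^2/2 and Lap(sigma) = -(n+3) sigma.  At a point p with
   p S^2 = (a+b) p S - ab p this is a multiple of sigma, so that harmonicity
   reduces to one scalar equation in t = |sigma|^2 and lambda.

   If p, q are unit eigenvectors for eigenvalues a <> b, then along the great
   circle through p and q one has t = T - l^2 with T = (a-b)^2/4 and
   l = lambda - (a+b)/2.  At l = 0 the equation gives C(T) - B'(T) <> 0; comparing
   it at l and -l then gives tr S = (n+1)(a+b)/2.  Since this holds for all pairs
   of distinct eigenvalues, there are exactly two, of equal multiplicity, and n is
   odd.  The equation becomes an ODE on ]0, T]; for n = 3 it says that
   2 t^2 (T-t) C - t^2 B, which is 0 at 0 and negative at T, has derivative
   t B > 0, which is absurd, and for n > 3, C = 0, it is
     (n+3) B + (2(n-3) T - (n-5) t) B' = 0. *)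

Require Import Defs.
From mathcomp Require Import all_boot all_order all_algebra.
From mathcomp Require Import all_classical all_reals all_analysis.
From mathcomp Require Import ring lra.

Set Implicit Arguments.
Unset Strict Implicit.
Unset Printing Implicit Defensive.

Import Order.TTheory GRing.Theory Num.Theory.
Import numFieldNormedType.Exports.

Local Open Scope classical_set_scope.
Local Open Scope ring_scope.

(** * Directional derivatives *)

(** The inverse of the Kaluza-Klein matrix is never computed: the tension field is paired with the
    vertical basis vectors, and positive definiteness makes the vanishing of these pairings
    equivalent to that of the vertical part. Passing to the chart of an orthogonal [Q] amounts to
    replacing [S] by [Q *m S *m Q^T] in the standard chart, so one computation serves all charts,
    and a Householder reflection centres a chart at any prescribed point. The relation p S^2 = (a+b)
    p S - ab p makes sigma an eigenvector of nabla sigma. It holds on every plane spanned by two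
    eigenvectors, which is enough for necessity, and on the whole sphere when there are only two
    eigenvalues, which is enough for sufficiency. The equality C(T) = B'(T) would leave (n+3)(B(T) +
    T C(T)) = 0, against positivity of the fibre metric in the radial direction. The comparison of l
    with -l is void at l = 0, so continuity has to carry C - B' <> 0 to nearby values of t. *)

Section Calculus.
Context {R : realType} {V : normedModType R}.
Implicit Types (f g : V -> R) (x v : V).

Lemma isD_add f g x v a b : is_derive x v f a -> is_derive x v g b ->
  is_derive x v (fun y => f y + g y) (a + b).
Proof. by move=> hf hg; exact: is_deriveD. Qed.

Lemma isD_opp f x v a : is_derive x v f a -> is_derive x v (fun y => - f y) (- a).
Proof. by move=> hf; exact: is_deriveN. Qed.

Lemma isD_mul f g x v a b : is_derive x v f a -> is_derive x v g b ->
  is_derive x v (fun y => f y * g y) (a * g x + f x * b).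
Proof.
move=> hf hg; apply: (is_derive_eq (is_deriveM hf hg)).
by rewrite addrC; congr (_ + _); exact: mulrC.
Qed.

Lemma isD_cst x v (c : R) : is_derive x v (fun=> c) 0.
Proof. exact: is_derive_cst. Qed.

Lemma isD_sum (I : finType) (P : pred I) (f : I -> V -> R) x v (a : I -> R) :
  (forall i, is_derive x v (f i) (a i)) ->
  is_derive x v (fun y => \sum_(i | P i) f i y) (\sum_(i | P i) a i).
Proof.
move=> h.
have -> : (fun y => \sum_(i | P i) f i y) = \sum_(i | P i) f i.
  by apply/funext => y; rewrite fct_sumE.
apply: (big_ind2 (fun F b => is_derive x v F b)) => [|F b G c|i _].
- exact: is_derive_cst.
- exact: is_deriveD.
- exact: h.
Qed.

Lemma derive_line (W : normedModType R) (u : V -> W) x v :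
  'D_v u x = 'D_1 (fun h : R => u (h *: v + x)) 0.
Proof.
rewrite /derive; set g1 := (fun h => h^-1 *: _); set g2 := (fun h => h^-1 *: _).
suff -> : g1 = g2 by [].
by apply/funext => h; rewrite /g1 /g2 /= addr0 scale0r add0r [_%:A]mulr1.
Qed.

(** Only the derivative of [f] along [v] is available, so [f] is restricted to the line through [x]
    in direction [v], where the one-variable chain rule applies. *)
Lemma isD_comp_at (B : R -> R) f x v a b :
  is_derive (f x) 1 B b -> is_derive x v f a ->
  is_derive x v (fun y => B (f y)) (b * a).
Proof.
move=> [dB <-] df.
pose c (h : R) := f (h *: v + x).
have c0 : c 0 = f x by rewrite /c scale0r add0r.
have dc : derivable c 0 1 by apply: (derivable1P f x v).1; case: df.
have dBc0 : derivable B (c 0) 1 := eq_ind_r (fun u => derivable B u 1) dB c0.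
have dBc : derivable (B \o c) 0 1.
  apply/derivable1_diffP; apply: differentiable_comp.
    exact: (derivable1_diffP _ _).1 dc.
  exact: (derivable1_diffP _ _).1 dBc0.
have E := derive1_comp dc dBc0.
apply: DeriveDef; first exact: (derivable1P _ _ _).2.
apply: (etrans (derive_line _ _ _)); apply: (etrans (esym (derive1E _ _))).
have BE := etrans (derive1E B (c 0)) (congr1 (fun u => 'D_1 B u) c0).
apply: (etrans E); apply: (congr2 *%R BE).
apply: (etrans (derive1E _ _)); apply: (etrans (esym (derive_line f x v))).
by case: df.
Qed.

Lemma isD_comp (B : R -> R) f x v a :
  (forall t, derivable B t 1) -> is_derive x v f a ->
  is_derive x v (fun y => B (f y)) (B^`()%classic (f x) * a).
Proof.
by move=> dB; apply: isD_comp_at; apply: DeriveDef; [exact: dB | rewrite derive1E].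
Qed.

Lemma isD_inv f x v a :
  f x != 0 -> is_derive x v f a ->
  is_derive x v (fun y => (f y)^-1) (- a / f x ^+ 2).
Proof.
move=> f0 [df <-]; apply: DeriveDef; first exact: derivableV.
by rewrite deriveV// mulNr mulrC -scaleNr.
Qed.

(** The derivative is an explicit argument: it is built by composing the rules below, then compared
    with the expected matrix through [mxD_eq]. *)
Definition mxD p q (A : V -> 'M[R]_(p, q)) x v (A' : 'M[R]_(p, q)) :=
  forall i j, is_derive x v (fun y => A y i j) (A' i j).

Lemma mxD_eq p q (A : V -> 'M[R]_(p, q)) x v A' A'' :
  mxD A x v A' -> A' = A'' -> mxD A x v A''.
Proof. by move=> h <-. Qed.

Lemma mxD_cst p q (A : 'M[R]_(p, q)) x v : mxD (fun=> A) x v 0.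
Proof. by move=> i j; rewrite mxE; exact: isD_cst. Qed.

Lemma mxD_add p q (A B : V -> 'M[R]_(p, q)) x v A' B' :
  mxD A x v A' -> mxD B x v B' -> mxD (fun y => A y + B y) x v (A' + B').
Proof.
move=> hA hB i j; rewrite mxE; under eq_fun do rewrite mxE.
exact: isD_add.
Qed.

Lemma mxD_opp p q (A : V -> 'M[R]_(p, q)) x v A' :
  mxD A x v A' -> mxD (fun y => - A y) x v (- A').
Proof.
move=> hA i j; rewrite mxE; under eq_fun do rewrite mxE; exact: isD_opp.
Qed.

Lemma mxD_scale p q f (A : V -> 'M[R]_(p, q)) x v a A' :
  is_derive x v f a -> mxD A x v A' ->
  mxD (fun y => f y *: A y) x v (a *: A x + f x *: A').
Proof.
move=> hf hA i j; rewrite !mxE; under eq_fun do rewrite mxE; exact: isD_mul.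
Qed.

Lemma mxD_mul p q r (A : V -> 'M[R]_(p, q)) (B : V -> 'M[R]_(q, r)) x v A' B' :
  mxD A x v A' -> mxD B x v B' ->
  mxD (fun y => A y *m B y) x v (A' *m B x + A x *m B').
Proof.
move=> hA hB i j; rewrite !mxE -big_split/=; under eq_fun do rewrite mxE.
by apply: isD_sum => k; exact: isD_mul.
Qed.

Lemma mxD_tr p q (A : V -> 'M[R]_(p, q)) x v A' :
  mxD A x v A' -> mxD (fun y => (A y)^T) x v A'^T.
Proof. by move=> hA i j; rewrite mxE; under eq_fun do rewrite mxE. Qed.

Lemma mxD_row p q r (A : V -> 'M[R]_(p, q)) (B : V -> 'M[R]_(p, r)) x v A' B' :
  mxD A x v A' -> mxD B x v B' ->
  mxD (fun y => row_mx (A y) (B y)) x v (row_mx A' B').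
Proof.
move=> hA hB i j; rewrite mxE; under eq_fun do rewrite mxE.
by case: (fintype.split j).
Qed.

Lemma mxD_scalar p f x v a :
  is_derive x v f a -> mxD (fun y => (f y)%:M : 'M[R]_p) x v a%:M.
Proof.
move=> hf i j; rewrite !mxE; under eq_fun do rewrite mxE.
by case: (i == j) => /=; rewrite ?mulr1n ?mulr0n //; exact: isD_cst.
Qed.

End Calculus.

Lemma mxD_id {R : realType} m (x v : 'rV[R]_m) : mxD id x v v.
Proof.
move=> i j; apply: DeriveDef.
  apply: diff_derivable; exact: differentiable_coord.
rewrite /derive; apply/cvg_lim => //; apply: (@cvg_trans _ (v i j @[h --> 0^'])); last exact: cvg_cst.
apply: near_eq_cvg; near=> h.
rewrite /= !mxE addrK [RHS]mulKf//.
by near: h; exact: nbhs_dnbhs_neq.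
Unshelve. all: by end_near. Qed.

Lemma continuous_derivable {R : realType} (f : R -> R) t : derivable f t 1 -> {for t, continuous f}.
Proof. by move=> /derivable1_diffP /differentiable_continuous. Qed.

(** * Stereographic coordinates of the round sphere *)

Lemma eq_row_mx (R : Type) m n1 n2 (A A' : 'M[R]_(m, n1)) (B B' : 'M[R]_(m, n2)) :
  A = A' -> B = B' -> row_mx A B = row_mx A' B'.
Proof. by move=> -> ->. Qed.

Section Dot.
Context {R : realType}.

Lemma dot_ge0 m (u : 'rV[R]_m) : 0 <= dot u u.
Proof. by rewrite /dot mxE sumr_ge0// => i _; rewrite mxE -expr2 sqr_ge0. Qed.

Lemma dot_eq0 m (u : 'rV[R]_m) : (dot u u == 0) = (u == 0).
Proof.
rewrite /dot mxE psumr_eq0; last by move=> i _; rewrite mxE -expr2 sqr_ge0.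
apply/allP/eqP => [h|-> i _]; last by rewrite /= !mxE mulr0 eqxx.
apply/rowP => i; apply/eqP; rewrite mxE.
by have := h i (mem_index_enum i); rewrite /= mxE mulf_eq0 orbb.
Qed.

Lemma dotE m (u v : 'rV[R]_m) : u *m v^T = (dot u v)%:M.
Proof. by rewrite [LHS]mx11_scalar. Qed.

Lemma dotC m (u v : 'rV[R]_m) : dot u v = dot v u.
Proof. by rewrite /dot -[v in RHS]trmxK -trmx_mul [RHS]mxE. Qed.

Lemma deltaE m (j : 'I_m) (u : 'rV[R]_m) : delta_mx 0 j *m u^T = (u 0 j)%:M.
Proof. by rewrite -rowE [LHS]mx11_scalar !mxE. Qed.

Lemma dotDl m (u v w : 'rV[R]_m) : dot (u + v) w = dot u w + dot v w.
Proof. by rewrite /dot mulmxDl mxE. Qed.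

Lemma dotZl m c (u w : 'rV[R]_m) : dot (c *: u) w = c * dot u w.
Proof. by rewrite /dot -scalemxAl mxE. Qed.

Lemma dotDr m (u v w : 'rV[R]_m) : dot w (u + v) = dot w u + dot w v.
Proof. by rewrite !(dotC w) dotDl. Qed.

Lemma dotZr m c (u w : 'rV[R]_m) : dot w (c *: u) = c * dot w u.
Proof. by rewrite !(dotC w) dotZl. Qed.

Lemma dotNl m (u w : 'rV[R]_m) : dot (- u) w = - dot u w.
Proof. by rewrite /dot mulNmx mxE. Qed.

Lemma dot0l m (w : 'rV[R]_m) : dot 0 w = 0.
Proof. by rewrite /dot mul0mx mxE. Qed.

Lemma dot_delta m i (u : 'rV[R]_m) : dot (delta_mx 0 i) u = u 0 i.
Proof. by rewrite /dot deltaE mxE eqxx mulr1n. Qed.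

Lemma dot_mulr_delta m (N : 'M[R]_m) i k : dot (delta_mx 0 i *m N) (delta_mx 0 k) = N i k.
Proof. by rewrite dotC dot_delta -rowE mxE. Qed.

Lemma dot_rows m (M N : 'M[R]_m) i j :
  dot (delta_mx 0 i *m M) (delta_mx 0 j *m N) = (M *m N^T) i j.
Proof.
by rewrite /dot trmx_mul mulmxA -[_ *m M *m _]mulmxA trmx_delta -colE -rowE !mxE.
Qed.

Lemma isD_dot2 (V : normedModType R) m (A A2 : V -> 'rV[R]_m) (p v : V) A' A2' :
  mxD A p v A' -> mxD A2 p v A2' ->
  is_derive p v (fun q => dot (A q) (A2 q)) (dot A' (A2 p) + dot (A p) A2').
Proof.
by move=> hA hA2; apply: (is_derive_eq (mxD_mul hA (mxD_tr hA2) 0 0)); rewrite mxE.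
Qed.

End Dot.

Section Stereo.
Context {R : realType} {n : nat}.
Implicit Types x y : 'rV[R]_n.

(** The conformal factor: in this chart the round metric is [rho ^+ 2] times the Euclidean one. *)
Definition rho x : R := 2 / (1 + dot x x).

Definition Jac x : 'M[R]_(n, 1 + n) :=
  row_mx (- rho x ^+ 2 *: x^T) ((rho x)%:M - rho x ^+ 2 *: (x^T *m x)).

(* [(Gam x j) i k] is the Christoffel symbol [Gamma^k_ij] of the round metric. *)
Definition Gam x (j : 'I_n) : 'M[R]_n :=
  - rho x *: (x 0 j *: 1%:M + x^T *m delta_mx 0 j - (delta_mx 0 j)^T *m x).

Lemma rho_gt0 x : 0 < rho x.
Proof. by rewrite divr_gt0// ltr_pwDl// dot_ge0. Qed.

Lemma rho_neq0 x : rho x != 0.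
Proof. by rewrite gt_eqF// rho_gt0. Qed.

(** With [rho x] and [dot x x] as atoms, the identities of the chart are polynomial modulo this
    single relation, which is handed to [ring]. *)
Lemma rho_dot x : rho x * dot x x = 2 - rho x.
Proof.
have h : 1 + dot x x != 0 by rewrite gt_eqF// ltr_pwDl// dot_ge0.
by rewrite /rho; field.
Qed.

Lemma stereoE x : stereo x =  row_mx (rho x - 1)%:M (rho x *: x).
Proof.
have h : 1 + dot x x != 0 by rewrite gt_eqF// ltr_pwDl// dot_ge0.
rewrite /stereo scale_row_mx scalerA -scalemx1 scalerA -[in RHS]scalemx1.
have -> : (1 + dot x x)^-1 * (1 - dot x x) = rho x - 1 by rewrite /rho; field.
by rewrite mulrC.
Qed.

Lemma isD_dot x j :
  is_derive x (delta_mx 0 j) (fun y => dot y y) (2 * x 0 j).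
Proof.
have h := mxD_mul (mxD_id x (delta_mx 0 j)) (mxD_tr (mxD_id x (delta_mx 0 j))).
apply: (is_derive_eq (h 0 0)); rewrite mxE deltaE dotE dotC -/(dot _ _).
by rewrite /dot deltaE !mxE mulr1n mulr2n mulrDl mul1r.
Qed.

Lemma isD_rho x j :
  is_derive x (delta_mx 0 j) rho (- rho x ^+ 2 * x 0 j).
Proof.
have h : 1 + dot x x != 0 by rewrite gt_eqF// ltr_pwDl// dot_ge0.
have hD := isD_add (isD_cst x (delta_mx 0 j) 1) (isD_dot x j).
have hI := isD_mul (isD_cst x (delta_mx 0 j) 2) (@isD_inv _ _ (fun y => 1 + dot y y) x _ _ h hD).
by rewrite /rho; apply: (is_derive_eq hI); field.
Qed.

Lemma mul_delta_Jac x j : delta_mx 0 j *m Jac x =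
  row_mx (- rho x ^+ 2 * x 0 j)%:M
         (rho x *: delta_mx 0 j - (rho x ^+ 2 * x 0 j) *: x).
Proof.
rewrite /Jac mul_mx_row mulmxBr -!scalemxAr mulmxA deltaE mul_mx_scalar.
by rewrite mul_scalar_mx scalerA scale_scalar_mx.
Qed.

Lemma mxD_stereo x j : @mxD R _ 1 (1 + n) (@stereo R n) x (delta_mx 0 j) (delta_mx 0 j *m Jac x).
Proof.
have -> : @stereo R n = fun y => row_mx (rho y - 1)%:M (rho y *: y).
  by apply/funext => y; rewrite stereoE.
have h0 := isD_add (isD_rho x j) (isD_cst x (delta_mx 0 j) (-1)).
have h1 := mxD_scale (isD_rho x j) (mxD_id x (delta_mx 0 j)).
apply: (mxD_eq (mxD_row (mxD_scalar (p := 1) h0) h1)); rewrite mul_delta_Jac addr0.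
by apply: eq_row_mx => //; rewrite addrC mulNr scaleNr.
Qed.

Lemma mul_row_Jac x : x *m Jac x =
  row_mx (rho x ^+ 2 - 2 * rho x)%:M ((rho x ^+ 2 - rho x) *: x).
Proof.
rewrite /Jac mul_mx_row mulmxBr -!scalemxAr mulmxA dotE mul_mx_scalar.
rewrite mul_scalar_mx scalerA scale_scalar_mx -scalerBl.
by apply: eq_row_mx; [congr (_%:M) | congr (_ *: _)]; ring: (rho_dot x).
Qed.

Lemma Gam_mul x j p (A : 'M[R]_(n, p)) : Gam x j *m A =
  - rho x *: (x 0 j *: A + x^T *m (delta_mx 0 j *m A)
              - (delta_mx 0 j)^T *m (x *m A)).
Proof.
by rewrite /Gam -scalemxAl mulmxBl mulmxDl -scalemxAl mul1mx !mulmxA.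
Qed.

(** Gauss formula for the sphere: the second derivatives of the embedding have the Christoffel
    symbols as tangential part, and minus the metric times the position vector as normal part. *)
Lemma mxD_Jac x j : mxD Jac x (delta_mx 0 j)
  (Gam x j *m Jac x - rho x ^+ 2 *: ((delta_mx 0 j)^T *m (stereo x : 'rV_(1 + n)))).
Proof.
set v := delta_mx 0 j.
have hr := isD_rho x j; have hx := mxD_id x v; have ht := mxD_tr hx.
have hr2 := isD_mul hr hr.
have h0 := mxD_scale (isD_opp hr2) ht.
have h1 := mxD_add (mxD_scalar (p := n) hr) (mxD_opp (mxD_scale hr2 (mxD_mul ht hx))).
apply: (mxD_eq (mxD_row h0 h1)).
rewrite Gam_mul mul_delta_Jac mul_row_Jac stereoE [in RHS]/Jac.
rewrite scale_row_mx !mul_mx_row add_row_mx opp_row_mx add_row_mx.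
rewrite !(scale_row_mx, opp_row_mx, add_row_mx).
apply: eq_row_mx; apply/matrixP => a b; rewrite !mxE !big_ord1 !mxE ?ord1 /=.
  by rewrite mulr1n; ring.
by case: (a == b); rewrite ?mulr0n ?mulr1n; ring.
Qed.

End Stereo.

(** * The tangent frame, and the first two covariant derivatives of lambda *)

Section Frame.
Context {R : realType} {n : nat}.
Implicit Types x y : 'rV[R]_n.

(* [Jac] at type [n.+1] instead of the convertible [1 + n], as required by
   products with [S]. *)
Definition frame x : 'M[R]_(n, n.+1) := Jac x.

Lemma mxD_chart x j : mxD (@stereo R n) x (delta_mx 0 j) (delta_mx 0 j *m frame x).
Proof. exact: mxD_stereo. Qed.

Lemma mxD_frame x j : mxD frame x (delta_mx 0 j)
  (Gam x j *m frame x - rho x ^+ 2 *: ((delta_mx 0 j)^T *m stereo x)).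
Proof. exact: mxD_Jac. Qed.

Lemma tr_Jac x : (Jac x)^T =
  col_mx (- rho x ^+ 2 *: x) ((rho x)%:M - rho x ^+ 2 *: (x^T *m x)).
Proof.
rewrite /Jac tr_row_mx; congr col_mx; first by rewrite linearZ/= trmxK.
by rewrite linearB linearZ/= tr_scalar_mx trmx_mul trmxK.
Qed.

Lemma dot_stereo x : dot (stereo x) (stereo x) = 1.
Proof.
have -> : dot (stereo x) (stereo x) =
    ((stereo x : 'rV_(1 + n)) *m (stereo x : 'rV_(1 + n))^T) 0 0 by [].
rewrite stereoE tr_row_mx mul_row_col tr_scalar_mx -scalar_mxM.
rewrite [(rho x *: x)^T]linearZ/= -scalemxAl -scalemxAr dotE !mxE /= !mulr1n.
ring: (rho_dot x).
Qed.

Lemma mul_stereo_frame x : stereo x *m (frame x)^T = 0.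
Proof.
change ((stereo x : 'rV_(1 + n)) *m (Jac x)^T = 0).
rewrite stereoE tr_Jac mul_row_col mul_scalar_mx mulmxBr -!scalemxAl -!scalemxAr.
rewrite mul_mx_scalar mulmxA dotE mul_scalar_mx !scalerA -scalerBl -scalerDl.
rewrite [X in X *: _](_ : _ = 0) ?scale0r//.
ring: (rho_dot x).
Qed.

Lemma frame_mul_tr x : frame x *m (frame x)^T = (rho x ^+ 2)%:M.
Proof.
change (Jac x *m (Jac x)^T = (rho x ^+ 2)%:M).
rewrite tr_Jac /Jac mul_row_col mulmxBr !mulmxBl -!scalemxAl -!scalemxAr -scalar_mxM.
rewrite mul_scalar_mx mul_mx_scalar -mulmxA [x *m _]mulmxA dotE mul_scalar_mx -scalemxAr.
rewrite !scalerA; apply/matrixP => a b; rewrite !mxE !big_ord1 !mxE.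
by case: (a == b) => /=; ring: (rho_dot x).
Qed.

(** The unit normal stacked on the rescaled tangent frame is a square matrix [O] with
    [O *m O^T = 1%:M]; the identity is [O^T *m O = 1%:M] read in blocks. It gives [rho ^+ 2] times
    the projection onto the tangent space. *)
Lemma tr_frame_mul x :
  (frame x)^T *m frame x = rho x ^+ 2 *: (1%:M - (stereo x)^T *m stereo x).
Proof.
have r0 := rho_neq0 x.
pose p : 'rV[R]_(1 + n) := stereo x; pose J : 'M[R]_(n, 1 + n) := frame x.
change (J^T *m J = rho x ^+ 2 *: (1%:M - p^T *m p)).
have h1 : p *m p^T = 1%:M.
  by change (stereo x *m (stereo x)^T = 1%:M); rewrite dotE dot_stereo.
have h2 : p *m J^T = 0 by exact: mul_stereo_frame.
have h3 : J *m J^T = (rho x ^+ 2)%:M by exact: frame_mul_tr.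
have h4 : J *m p^T = 0 by rewrite -[J]trmxK -trmx_mul h2 trmx0.
move: p J h1 h2 h3 h4 => p J h1 h2 h3 h4.
pose O : 'M[R]_(1 + n) := col_mx p ((rho x)^-1 *: J).
have /mulmx1C : O *m O^T = 1%:M.
  rewrite /O tr_col_mx mul_col_row [(_ *: J)^T]linearZ/= -!scalemxAl -!scalemxAr.
  rewrite h1 h2 h3 h4 !scaler0 !scale_scalar_mx.
  have -> : (rho x)^-1 * ((rho x)^-1 * rho x ^+ 2) = 1 by field.
  by rewrite -scalar_mx_block.
rewrite /O tr_col_mx mul_row_col [(_ *: J)^T]linearZ/= -!scalemxAl -!scalemxAr scalerA => <-.
rewrite addrC addKr scalerA.
have -> : rho x ^+ 2 * ((rho x)^-1 * (rho x)^-1) = 1 by field.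
by rewrite scale1r.
Qed.

(** Compatibility of the connection with the conformal metric: [Gam] plus its transpose is the
    derivative of ln(rho^2) times the identity. *)
Lemma tr_Gam x j : (Gam x j)^T = - Gam x j - (2 * rho x * x 0 j)%:M.
Proof.
apply/matrixP => a b; rewrite !mxE !big_ord1 !mxE (eq_sym b a).
by case: (a == b) => /=; ring.
Qed.

Variable S : 'M[R]_n.+1.
Hypothesis symS : S^T = S.

Definition lam x : R := dot (stereo x *m S) (stereo x).

(* For [sigma = 1/2 grad lambda] and [X_i = d/dx_i], [uvec] has entries
   [g(sigma, X_i)] and [Nmx] has entries [g(nabla_(X_i) sigma, X_j)]. *)
Definition uvec x : 'rV[R]_n := stereo x *m S *m (frame x)^T.

Definition Nmx x : 'M[R]_n := frame x *m S *m (frame x)^T - (lam x * rho x ^+ 2)%:M.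

Lemma lamE x : stereo x *m S *m (stereo x)^T = (lam x)%:M.
Proof. exact: dotE. Qed.

Lemma frame_stereo x : frame x *m S *m (stereo x)^T = (uvec x)^T.
Proof. by rewrite /uvec !trmx_mul symS trmxK mulmxA. Qed.

Lemma tr_Nmx x : (Nmx x)^T = Nmx x.
Proof.
by rewrite /Nmx linearB/= tr_scalar_mx !trmx_mul symS trmxK mulmxA.
Qed.

Lemma isD_lam x j : is_derive x (delta_mx 0 j) lam (2 * uvec x 0 j).
Proof.
have h0 := mxD_chart x j.
have h1 := mxD_mul h0 (mxD_cst S x (delta_mx 0 j)).
apply: (is_derive_eq (mxD_mul h1 (mxD_tr h0) 0 0)).
have -> : stereo x *m S *m (delta_mx 0 j *m frame x)^T = (uvec x 0 j)%:M.
  by rewrite trmx_mul mulmxA -/(uvec x); apply: trmx_inj; rewrite trmx_mul trmxK tr_scalar_mx deltaE.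
rewrite mulmx0 addr0 -[_ *m S *m _]mulmxA -mulmxA [frame x *m _]mulmxA.
rewrite frame_stereo deltaE !mxE /= !mulr1n; ring.
Qed.

(** The second summand is the connection term, so [Nmx] is the covariant derivative of [uvec], that
    is, half the Hessian of lambda. *)
Lemma mxD_uvec x j : mxD uvec x (delta_mx 0 j)
  (delta_mx 0 j *m Nmx x + uvec x *m (Gam x j)^T).
Proof.
have h0 := mxD_chart x j.
have h1 := mxD_mul h0 (mxD_cst S x (delta_mx 0 j)).
apply: (mxD_eq (mxD_mul h1 (mxD_tr (mxD_frame x j)))).
rewrite mulmx0 addr0 linearB/= linearZ/= !trmx_mul trmxK mulmxBr -scalemxAr !mulmxA.
rewrite lamE mul_scalar_mx scalerA -/(uvec x) /Nmx mulmxBr mul_mx_scalar !mulmxA.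
by rewrite mulrC addrA addrAC.
Qed.

(** Apart from the two connection terms, this is the covariant derivative of half the Hessian. For a
    quadratic form it involves [uvec] alone, and contracting two indices gives the n + 3 of
    Lap(sigma) = -(n+3) sigma. *)
Lemma mxD_Nmx x j : mxD Nmx x (delta_mx 0 j)
  (Gam x j *m Nmx x + Nmx x *m (Gam x j)^T
   - rho x ^+ 2 *: ((delta_mx 0 j)^T *m uvec x + (uvec x)^T *m delta_mx 0 j
                    + (2 * uvec x 0 j)%:M)).
Proof.
have hF := mxD_frame x j.
have h1 := mxD_mul (mxD_mul hF (mxD_cst S x (delta_mx 0 j))) (mxD_tr hF).
have hr := isD_rho x j.
have h2 := mxD_scalar (p := n) (isD_mul (isD_lam x j) (isD_mul hr hr)).
apply: (mxD_eq (mxD_add h1 (mxD_opp h2))).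
set G := Gam x j *m frame x - _.
have ME : frame x *m S *m (frame x)^T = Nmx x + (lam x * rho x ^+ 2)%:M.
  by rewrite subrK.
have trM : (Nmx x + (lam x * rho x ^+ 2)%:M)^T = Nmx x + (lam x * rho x ^+ 2)%:M.
  by rewrite -ME !trmx_mul trmxK symS mulmxA.
have L1 : G *m S *m (frame x)^T = Gam x j *m (Nmx x + (lam x * rho x ^+ 2)%:M)
    - rho x ^+ 2 *: ((delta_mx 0 j)^T *m uvec x).
  by rewrite -ME /G !mulmxBl -!scalemxAl /uvec !mulmxA.
have L2 : frame x *m S *m G^T = (Nmx x + (lam x * rho x ^+ 2)%:M) *m (Gam x j)^T
    - rho x ^+ 2 *: ((uvec x)^T *m delta_mx 0 j).
  apply: trmx_inj; rewrite [LHS]trmx_mul trmxK [(frame x *m S)^T]trmx_mul symS mulmxA L1.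
  have tZ (u : 'rV[R]_n) : (rho x ^+ 2 *: (u^T *m delta_mx 0 j))^T
      = rho x ^+ 2 *: ((delta_mx 0 j)^T *m u) by rewrite linearZ/= trmx_mul trmxK.
  by rewrite [RHS]linearB/= tZ trmx_mul trmxK trM.
rewrite mulmx0 addr0 L1 L2 mulmxDr mulmxDl mul_mx_scalar mul_scalar_mx tr_Gam.
move: (Gam x j) (Nmx x) (uvec x) => H N u.
apply/matrixP => a b; rewrite !mxE !big_ord1 !mxE.
case: (a == b) => /=; ring.
Qed.

End Frame.

(** * The tension field with lowered index *)

Section LoweredTension.
Context {R : realType}.

Lemma derive_coords k (f : 'rV[R]_k -> R) (z w : 'rV[R]_k) :
  differentiable f z -> 'D_w f z = \sum_b w 0 b * partial b f z.
Proof.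
move=> df; rewrite deriveE// {1}[w]row_sum_delta linear_sum/=.
by apply: eq_bigr => b _; rewrite linearZ/= -deriveE.
Qed.

Lemma isD_chain (V : normedModType R) k (f : 'rV[R]_k -> R) (F : V -> 'rV[R]_k)
    (x v : V) (w : 'rV[R]_k) :
  differentiable f (F x) -> mxD F x v w ->
  is_derive x v (fun y => f (F y)) (\sum_b w 0 b * partial b f (F x)).
Proof.
move=> df dF.
have dFx : derivable F x v.
  by apply/derivable_mxP => i j; case: (dF i j).
have dFE : 'D_v F x = w.
  rewrite derive_mx//; apply/matrixP => i j; rewrite mxE.
  by case: (dF i j).
pose c (h : R) := F (h *: v + x).
have c0 : c 0 = F x by rewrite /c scale0r add0r.
have dc : differentiable c (0 : R).
  by apply: (derivable1_diffP _ _).1; exact: (derivable1P F x v).1.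
have df0 : differentiable f (c 0) by rewrite c0.
have dfc : differentiable (f \o c) (0 : R) by exact: differentiable_comp.
apply: DeriveDef.
  by apply: (derivable1P _ _ _).2; exact: (derivable1_diffP _ _).2 dfc.
apply: (etrans (derive_line _ _ _)); apply: (etrans (deriveE _ dfc)).
rewrite diff_comp//= -(deriveE _ dc) -/c.
have -> : 'D_1 c 0 = w by rewrite -dFE; exact: (esym (derive_line F x v)).
by rewrite c0 -deriveE// derive_coords.
Qed.

Variables (m k : nat) (g : 'rV[R]_m -> 'M[R]_m) (h : 'rV[R]_k -> 'M[R]_k).
Variables (F : 'rV[R]_m -> 'rV[R]_k) (x : 'rV[R]_m).
Hypothesis gs : forall i j, invmx (g x) i j = invmx (g x) j i.
Hypothesis hs : forall z a b, h z a b = h z b a.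
Hypothesis hu : h (F x) \in unitmx.
Hypothesis hd : forall a b, differentiable (fun z => h z a b) (F x).

Let D i a := partial i (fun y => F y 0 a) x.

Hypothesis dF : forall i, mxD F x (delta_mx 0 i) (\row_a D i a).
Hypothesis ddF : forall i j a,
  derivable (fun y => partial j (fun y' => F y' 0 a) y) x (delta_mx 0 i).

(** The inverse matrix inside the symbols cancels against [h], leaving the Christoffel symbols of
    the first kind. *)
Lemma christoffel_lower d b c :
  \sum_a h (F x) d a * christoffel h a b c (F x) =
  2^-1 * (partial b (fun z => h z d c) (F x) + partial c (fun z => h z d b) (F x)
          - partial d (fun z => h z b c) (F x)).
Proof.
pose X l := partial b (fun z => h z c l) (F x) + partial c (fun z => h z b l) (F x)
          - partial l (fun z => h z b c) (F x).
have -> : \sum_a h (F x) d a * christoffel h a b c (F x) =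
    2^-1 * \sum_l (h (F x) *m invmx (h (F x))) d l * X l.
  under eq_bigr => a _ do rewrite /christoffel mulrCA mulr_sumr.
  rewrite -mulr_sumr exchange_big/=; congr (_ * _); apply: eq_bigr => l _.
  rewrite mxE mulr_suml; apply: eq_bigr => a _; by rewrite mulrA.
rewrite mulmxV// (bigD1 d)//= big1 => [|l ld]; last first.
  by rewrite mxE eq_sym (negPf ld) mul0r.
rewrite mxE eqxx mul1r addr0 /X.
have hsE u : (fun z => h z u d) = (fun z => h z d u) by apply/funext => z.
by rewrite !hsE.
Qed.

(* Lowering the index of the tension field with [h] produces its Euler-Lagrange
   form, in which the Christoffel symbols of [h] have disappeared. *)
Lemma lowered_tension d :
  \sum_a h (F x) d a * tension g h F x 0 a =
  \sum_i \sum_j invmx (g x) i j *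
    (partial i (fun y => \sum_a h (F y) d a * partial j (fun y' => F y' 0 a) y) x
     - \sum_l christoffel g l i j x * (\sum_a h (F x) d a * D l a)
     - 2^-1 * \sum_b \sum_c partial d (fun z => h z b c) (F x) * D i b * D j c).
Proof.
pose H a := h (F x) d a.
pose dh b c := partial b (fun z => h z d c) (F x).
pose K i j := \sum_b \sum_c dh b c * D i b * D j c.
pose L i j := \sum_b \sum_c partial d (fun z => h z b c) (F x) * D i b * D j c.
pose T i j a := partial i (fun y => partial j (fun y' => F y' 0 a) y) x.
have E1 i j : partial i (fun y => \sum_a h (F y) d a * partial j (fun y' => F y' 0 a) y) x
    = K i j + \sum_a H a * T i j a.
  have hD : is_derive x (delta_mx 0 i)
      (fun y => \sum_a h (F y) d a * partial j (fun y' => F y' 0 a) y)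
      (\sum_a ((\sum_b (\row_a D i a) 0 b * partial b (fun z => h z d a) (F x))
               * D j a + H a * T i j a)).
    apply: isD_sum => a; apply: isD_mul; first exact: isD_chain.
    exact: derivableP.
  rewrite /partial; case: hD => _ ->; rewrite big_split/=; congr (_ + _).
  rewrite /K exchange_big/=; apply: eq_bigr => a _; rewrite mulr_suml.
  by apply: eq_bigr => b _; rewrite mxE [D i b * _]mulrC.
have E2 i j : \sum_a H a * (\sum_b \sum_c christoffel h a b c (F x) * D i b * D j c)
    = 2^-1 * (K i j + K j i - L i j).
  under eq_bigr => a _ do rewrite mulr_sumr.
  rewrite exchange_big/= /K /L [X in _ + X - _]exchange_big/= -big_split/= -sumrB mulr_sumr.
  apply: eq_bigr => b _.
  under eq_bigr => a _ do rewrite mulr_sumr.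
  rewrite exchange_big/= -big_split/= -sumrB mulr_sumr.
  apply: eq_bigr => c _.
  under eq_bigr => a _ do
    rewrite (mulrA (H a) _ (D j c)) (mulrA (H a) (christoffel h a b c (F x)) (D i b)).
  rewrite -!mulr_suml (christoffel_lower d b c) /dh; ring.
have KS : \sum_i \sum_j invmx (g x) i j * K j i = \sum_i \sum_j invmx (g x) i j * K i j.
  rewrite exchange_big/=; apply: eq_bigr => i _; apply: eq_bigr => j _.
  by rewrite gs.
have -> : \sum_a H a * tension g h F x 0 a = \sum_i \sum_j invmx (g x) i j *
   (\sum_a H a * T i j a - \sum_l christoffel g l i j x * (\sum_a H a * D l a)
    + 2^-1 * (K i j + K j i - L i j)).
  under eq_bigr => a _ do rewrite mxE mulr_sumr.
  rewrite exchange_big/=; apply: eq_bigr => i _.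
  under eq_bigr => a _ do rewrite mulr_sumr.
  rewrite exchange_big/=; apply: eq_bigr => j _.
  rewrite -E2 -/(H _) -/(T _ _ _).
  have -> : \sum_l christoffel g l i j x * (\sum_a H a * D l a) =
     \sum_a H a * \sum_l christoffel g l i j x * D l a.
    under eq_bigr => l _ do rewrite mulr_sumr.
    rewrite exchange_big/=; apply: eq_bigr => a _; rewrite mulr_sumr.
    by apply: eq_bigr => l _; rewrite mulrCA.
  rewrite -sumrB -big_split/= mulr_sumr; apply: eq_bigr => a _.
  by rewrite mulrCA -mulrBr -mulrDr.
(* By [KS] the added zero is half the sum of [K i j] minus half the sum of [K j i]; with it the two
   sides agree term by term in [i] and [j]. *)
rewrite -[LHS]addr0 -[X in _ + X](subrr (2^-1 * \sum_i \sum_j invmx (g x) i j * K i j)).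
rewrite -{2}KS !mulr_sumr -sumrB -big_split/=; apply: eq_bigr => i _.
rewrite !mulr_sumr -sumrB -big_split/=; apply: eq_bigr => j _.
rewrite E1 -/(L i j).
set A := \sum_a H a * T i j a; set B := \sum_l christoffel g l i j x * (\sum_a H a * D l a).
move: A B (K i j) (K j i) (L i j) (invmx (g x) i j) => A B k1 k2 l1 c.
by field.
Qed.

End LoweredTension.

(** * The Kaluza-Klein metric in coordinates *)

Section Differentiability.
Context {R : realType} {V : normedModType R}.
Implicit Types (f g : V -> R) (x : V).

Lemma df_add f g x : differentiable f x -> differentiable g x ->
  differentiable (fun y => f y + g y) x.
Proof. exact: differentiableD. Qed.

Lemma df_mul f g x : differentiable f x -> differentiable g x ->
  differentiable (fun y => f y * g y) x.
Proof. exact: differentiableM. Qed.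

Lemma df_cst x (c : R) : differentiable (fun=> c) x.
Proof. exact: differentiable_cst. Qed.

Lemma df_sum (I : finType) (f : I -> V -> R) x :
  (forall i, differentiable (f i) x) ->
  differentiable (fun y => \sum_i f i y) x.
Proof.
move=> h.
have -> : (fun y => \sum_i f i y) = \sum_i f i.
  by apply/funext => y; rewrite fct_sumE.
elim/big_ind : _ => [|F G|i _]; [exact: df_cst | exact: differentiableD | exact: h].
Qed.

Lemma df_comp (B : R -> R) f x :
  (forall t, derivable B t 1) -> differentiable f x ->
  differentiable (fun y => B (f y)) x.
Proof.
by move=> dB df; apply: differentiable_comp => //; exact: (derivable1_diffP _ _).1.
Qed.

(** Directional derivatives do not suffice for the outer function of [isD_chain]; the Kaluza-Klein
    matrix must be differentiable in the full sense. *)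
Definition mxdf p q (A : V -> 'M[R]_(p, q)) x :=
  forall i j, differentiable (fun y => A y i j) x.

Lemma mxdf_cst p q (A : 'M[R]_(p, q)) x : mxdf (fun=> A) x.
Proof. by move=> i j; exact: df_cst. Qed.

Lemma mxdf_add p q (A B : V -> 'M[R]_(p, q)) x :
  mxdf A x -> mxdf B x -> mxdf (fun y => A y + B y) x.
Proof.
by move=> hA hB i j; under eq_fun do rewrite mxE; exact: df_add.
Qed.

Lemma mxdf_scale p q f (A : V -> 'M[R]_(p, q)) x :
  differentiable f x -> mxdf A x -> mxdf (fun y => f y *: A y) x.
Proof.
by move=> hf hA i j; under eq_fun do rewrite mxE; exact: df_mul.
Qed.

Lemma mxdf_mul p q r (A : V -> 'M[R]_(p, q)) (B : V -> 'M[R]_(q, r)) x :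
  mxdf A x -> mxdf B x -> mxdf (fun y => A y *m B y) x.
Proof.
move=> hA hB i j; under eq_fun do rewrite mxE.
by apply: df_sum => k; exact: df_mul.
Qed.

Lemma mxdf_tr p q (A : V -> 'M[R]_(p, q)) x :
  mxdf A x -> mxdf (fun y => (A y)^T) x.
Proof. by move=> hA i j; under eq_fun do rewrite mxE; exact: hA. Qed.

Lemma df_dot p (A B : V -> 'rV[R]_p) x :
  mxdf A x -> mxdf B x -> differentiable (fun y => dot (A y) (B y)) x.
Proof. by move=> hA hB; exact: (mxdf_mul hA (mxdf_tr hB) 0 0). Qed.

Lemma df_rho n (A : V -> 'rV[R]_n) x :
  mxdf A x -> differentiable (fun y => rho (A y)) x.
Proof.
move=> hA; apply: df_mul; first exact: df_cst.
apply: differentiableV; first exact: df_add (df_cst _ _) (df_dot hA hA).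
by rewrite gt_eqF// ltr_pwDl// dot_ge0.
Qed.

Lemma mxdf_Gam n (A : V -> 'rV[R]_n) x i :
  mxdf A x -> mxdf (fun y => Gam (A y) i) x.
Proof.
move=> hA; apply: mxdf_scale.
  have -> : (fun y => - rho (A y)) = (fun y => -1 * rho (A y)).
    by apply/funext => y; rewrite mulN1r.
  exact: df_mul (df_cst _ _) (df_rho hA).
apply: mxdf_add; first apply: mxdf_add.
- by apply: mxdf_scale; [exact: hA | exact: mxdf_cst].
- exact: mxdf_mul (mxdf_tr hA) (mxdf_cst _ _).
- under [fun=> _]eq_fun do rewrite -mulNmx.
  exact: mxdf_mul (mxdf_cst _ _) hA.
Qed.

End Differentiability.

Lemma mxdf_id {R : realType} m (x : 'rV[R]_m) : mxdf id x.
Proof. by move=> i j; exact: differentiable_coord. Qed.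

Lemma posdef_unitmx {R : realType} m (M : 'M[R]_m) : posdef M -> M \in unitmx.
Proof.
move=> pM; rewrite -row_free_unit -kermx_eq0; apply/negPn/negP => /rowV0Pn[v].
move=> /sub_kermxP vM v0; have := pM v v0.
by rewrite /ip vM mul0mx mxE ltxx.
Qed.

Section RoundMetric.
Context {R : realType} {n : nat}.
Implicit Types (x e X : 'rV[R]_n) (z w : 'rV[R]_(n + n)) (S Q : 'M[R]_n.+1).

Definition conf_metric x : 'M[R]_n := (rho x ^+ 2)%:M.

Lemma invmx_conf x : invmx (conf_metric x) = (rho x ^- 2)%:M.
Proof. by rewrite /conf_metric invmx_scalar. Qed.

Lemma partial_chart Q i k x :
  partial i (fun y => chart Q y 0 k) x = (frame x *m Q) i k.
Proof.
have h := mxD_mul (mxD_chart x i) (mxD_cst Q x (delta_mx 0 i)) 0 k.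
rewrite /partial; case: h => _ ->.
by rewrite mulmx0 addr0 -mulmxA -rowE mxE.
Qed.

(** An orthogonal [Q] is an isometry of the ambient space and drops out of the pullback, so all
    charts share the same Christoffel symbols and the same Kaluza-Klein matrix. *)
Lemma round_metricE Q : orthogonal_mx Q -> round_metric Q = conf_metric.
Proof.
move=> hQ; apply/funext => x; rewrite /conf_metric -frame_mul_tr.
have -> : frame x *m (frame x)^T = (frame x *m Q) *m (frame x *m Q)^T.
  by rewrite trmx_mul mulmxA -[X in _ = X *m _]mulmxA hQ mulmx1.
apply/matrixP => i j; rewrite mxE [RHS]mxE; apply: eq_bigr => k _.
by rewrite !partial_chart [(_^T) k j]mxE.
Qed.

Lemma Gam_sym x i j k : Gam x i j k = Gam x j i k.
Proof.
rewrite /Gam !mxE !big_ord1 !mxE (eq_sym j i) (eq_sym k i) (eq_sym k j) !ord1 eqxx /=.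
ring.
Qed.

Lemma partial_conf x i a b :
  partial i (fun y => conf_metric y a b) x = - 2 * rho x ^+ 3 * x 0 i * (a == b)%:R.
Proof.
have hr := isD_rho x i.
have h := mxD_scalar (p := n) (isD_mul hr hr) a b.
rewrite /partial; case: h => _ ->.
by rewrite mxE; case: (a == b) => /=; ring.
Qed.

Lemma christoffel_conf k i j x : christoffel conf_metric k i j x = Gam x j i k.
Proof.
have r0 := rho_neq0 x.
rewrite /christoffel invmx_conf (bigD1 k)//= big1 => [|l lk]; last first.
  by rewrite mxE eq_sym (negPf lk) mulr0n mul0r.
rewrite !partial_conf addr0 !mxE !big_ord1 !mxE !ord1 eqxx /= mulr1n.
rewrite (eq_sym k j).
by field.
Qed.

Lemma christoffel_appE x X e :
  christoffel_app conf_metric x X e = \sum_i X 0 i *: (e *m Gam x i).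
Proof.
apply/rowP => k; rewrite mxE summxE; apply: eq_bigr => i _.
rewrite !mxE mulr_sumr; apply: eq_bigr => j _.
by rewrite christoffel_conf Gam_sym; ring.
Qed.

Lemma christoffel_app_delta x i e :
  christoffel_app conf_metric x (delta_mx 0 i) e = e *m Gam x i.
Proof.
rewrite christoffel_appE (bigD1 i)//= big1 => [|l lk]; last first.
  by rewrite mxE (negPf lk) scale0r.
by rewrite mxE !eqxx scale1r addr0.
Qed.

Lemma ip_scalar (c : R) (u v : 'rV[R]_n) : ip c%:M u v = c * dot u v.
Proof. by rewrite /ip mul_mx_scalar -scalemxAl mxE. Qed.

Section KK.
Variables B C : R -> R.

Lemma kk_formE z w w' :
  let r := rho (lsubmx z) in let e := rsubmx z in let t := r ^+ 2 * dot e e in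
  let v := vpart conf_metric z w in let v' := vpart conf_metric z w' in
  kk_form conf_metric (cst 1) B C z w w' =
  r ^+ 2 * dot (lsubmx w) (lsubmx w') + B t * (r ^+ 2 * dot v v')
  + C t * (r ^+ 2 * dot v e) * (r ^+ 2 * dot v' e).
Proof. by rewrite /= /kk_form !ip_scalar mul1r. Qed.

Lemma vpartD z w w' a : vpart conf_metric z (a *: w + w') = a *: vpart conf_metric z w + vpart conf_metric z w'.
Proof.
rewrite /vpart !christoffel_appE !linearP/= scalerDr addrACA; congr (_ + _).
rewrite scaler_sumr -big_split/=; apply: eq_bigr => i _.
by rewrite !mxE scalerDl scalerA.
Qed.

Lemma kk_formC z w w' : kk_form conf_metric (cst 1) B C z w w' = kk_form conf_metric (cst 1) B C z w' w.
Proof.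
rewrite !kk_formE dotC [dot (vpart _ _ _) (vpart _ _ _)]dotC; ring.
Qed.

Lemma kk_formDr z w1 w' w'' a :
  kk_form conf_metric (cst 1) B C z w1 (a *: w' + w'') =
  a * kk_form conf_metric (cst 1) B C z w1 w' + kk_form conf_metric (cst 1) B C z w1 w''.
Proof.
by rewrite !kk_formE !vpartD linearP/= !(dotDl, dotDr, dotZl, dotZr); ring.
Qed.

Lemma kk_form0r z w : kk_form conf_metric (cst 1) B C z w 0 = 0.
Proof.
have := kk_formDr z w 0 0 1; rewrite scaler0 addr0 mul1r => h.
by apply: (addrI (kk_form conf_metric (cst 1) B C z w 0)); rewrite addr0 -h.
Qed.

Lemma kk_form_sumr z w (a : 'I_(n + n) -> R) (w' : 'I_(n + n) -> 'rV[R]_(n + n)) :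
  kk_form conf_metric (cst 1) B C z w (\sum_i a i *: w' i) =
  \sum_i a i * kk_form conf_metric (cst 1) B C z w (w' i).
Proof.
apply: (big_rec2 (fun u v => kk_form conf_metric (cst 1) B C z w u = v)) => [|i u v _ <-].
  exact: kk_form0r.
exact: kk_formDr.
Qed.

Lemma kk_metric_mulr z a w :
  \sum_b kk_metric conf_metric (cst 1) B C z a b * w 0 b =
  kk_form conf_metric (cst 1) B C z (delta_mx 0 a) w.
Proof.
rewrite {2}[w]row_sum_delta kk_form_sumr; apply: eq_bigr => b _.
by rewrite mxE mulrC.
Qed.

Lemma kk_metric_ip z w w' :
  ip (kk_metric conf_metric (cst 1) B C z) w w' = kk_form conf_metric (cst 1) B C z w w'.
Proof.
rewrite /ip -mulmxA mxE kk_formC {2}[w]row_sum_delta kk_form_sumr.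
apply: eq_bigr => a _; rewrite kk_formC -kk_metric_mulr mxE.
by congr (_ * _); apply: eq_bigr => b _; rewrite [(_^T) b 0]mxE.
Qed.

Lemma kk_metric_sym z a b :
  kk_metric conf_metric (cst 1) B C z a b = kk_metric conf_metric (cst 1) B C z b a.
Proof. by rewrite !mxE kk_formC. Qed.

Lemma mxdf_lsubmx z : mxdf (fun z => lsubmx z : 'rV[R]_n) z.
Proof. by move=> i j; under eq_fun do rewrite mxE; exact: differentiable_coord. Qed.

Lemma mxdf_rsubmx z : mxdf (fun z => rsubmx z : 'rV[R]_n) z.
Proof. by move=> i j; under eq_fun do rewrite mxE; exact: differentiable_coord. Qed.

Lemma mxdf_vpart z w : mxdf (fun z => vpart conf_metric z w) z.
Proof.
move=> i j; under eq_fun do rewrite /vpart mxE christoffel_appE summxE.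
apply: df_add; first exact: df_cst.
apply: df_sum => k; under eq_fun do rewrite mxE.
apply: df_mul; first exact: df_cst.
exact: mxdf_mul (mxdf_rsubmx z) (mxdf_Gam k (mxdf_lsubmx z)) i j.
Qed.

Hypotheses (dB : forall t, derivable B t 1) (dC : forall t, derivable C t 1).

Lemma df_kk_form z w w' :
  differentiable (fun z => kk_form conf_metric (cst 1) B C z w w') z.
Proof.
under eq_fun do rewrite kk_formE.
have hr := df_rho (mxdf_lsubmx z); have hr2 := df_mul hr hr.
have he := mxdf_rsubmx z; have hv := mxdf_vpart z w; have hv' := mxdf_vpart z w'.
have hB := df_comp dB (df_mul hr2 (df_dot he he)).
have hC := df_comp dC (df_mul hr2 (df_dot he he)).
have h1 := df_mul hr2 (df_cst z (dot (lsubmx w) (lsubmx w'))).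
have h2 := df_mul hB (df_mul hr2 (df_dot hv hv')).
have h3 := df_mul (df_mul hC (df_mul hr2 (df_dot hv he))) (df_mul hr2 (df_dot hv' he)).
exact: df_add (df_add h1 h2) h3.
Qed.

End KK.
End RoundMetric.

(** * The vertical tension of the gradient of a quadratic form *)

Section QuadraticSection.
Context {R : realType} {n : nat}.
Variable S : 'M[R]_n.+1.
Hypothesis symS : S^T = S.
Implicit Types (x y : 'rV[R]_n).

(** The coordinates of sigma itself: the index of [uvec] raised with the inverse metric. *)
Definition svec y : 'rV[R]_n := rho y ^- 2 *: uvec S y.

(** The covector with entries g(nabla_(X_i) sigma, sigma), half the differential of [sqnorm]. *)
Definition bvec y : 'rV[R]_n := rho y ^- 2 *: (uvec S y *m Nmx S y).

Definition sqnorm y : R := rho y ^- 2 * dot (uvec S y) (uvec S y).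

Definition sect y : 'rV[R]_(n + n) := row_mx y (svec y).

Lemma isD_rhoV2 x j :
  is_derive x (delta_mx 0 j) (fun y => rho y ^- 2) (2 * x 0 j / rho x).
Proof.
have r0 := rho_neq0 x; have hr := isD_rho x j.
have r20 : rho x * rho x != 0 by rewrite mulf_neq0.
have h := @isD_inv _ _ (fun y => rho y * rho y) x _ _ r20 (isD_mul hr hr).
apply: (is_derive_eq h); by field.
Qed.

Lemma mxD_svec x j : mxD svec x (delta_mx 0 j)
  (rho x ^- 2 *: (delta_mx 0 j *m Nmx S x) - svec x *m Gam x j).
Proof.
have r0 := rho_neq0 x.
have h : mxD svec x (delta_mx 0 j) _ := mxD_scale (isD_rhoV2 x j) (mxD_uvec S x j).
apply: (mxD_eq h).
rewrite tr_Gam [uvec S x *m _]mulmxBr mulmxN mul_mx_scalar /svec -scalemxAl.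
move: (delta_mx 0 j *m _) (uvec S x) => v u; move: (u *m _) => w.
by apply/rowP => k; rewrite !mxE; field.
Qed.

Definition dsect x j : 'rV[R]_(n + n) :=
  row_mx (delta_mx 0 j) (rho x ^- 2 *: (delta_mx 0 j *m Nmx S x) - svec x *m Gam x j).

Lemma mxD_sect x j : mxD sect x (delta_mx 0 j) (dsect x j).
Proof. exact: mxD_row (mxD_id _ _) (mxD_svec x j). Qed.

(** The Christoffel term in the derivative of the coordinates of sigma is undone by the correction
    in [vpart]: the vertical part of d sigma(X_j) is nabla_(X_j) sigma. *)
Lemma vpart_dsect x j :
  vpart conf_metric (sect x) (dsect x j) = rho x ^- 2 *: (delta_mx 0 j *m Nmx S x).
Proof. by rewrite /vpart /sect /dsect !row_mxKl !row_mxKr christoffel_app_delta subrK. Qed.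

Lemma sqnormE x : sqnorm x = rho x ^+ 2 * dot (svec x) (svec x).
Proof. by rewrite /sqnorm /svec dotZl dotZr; field; exact: rho_neq0. Qed.

(** A quadratic form sees only the symmetric part of [Gam], which [tr_Gam] identifies as a scalar
    matrix. *)
Lemma dot_mul_Gam (u : 'rV[R]_n) x j :
  dot (u *m (Gam x j)^T) u = - rho x * x 0 j * dot u u.
Proof.
have h1 : dot (u *m (Gam x j)^T) u = dot (u *m Gam x j) u.
  by rewrite dotC /dot trmx_mul trmxK !mulmxA.
have h2 : dot (u *m (Gam x j)^T) u = - dot (u *m Gam x j) u - 2 * rho x * x 0 j * dot u u.
  by rewrite tr_Gam mulmxBr mulmxN mul_mx_scalar dotDl !dotNl dotZl.
have : dot (u *m (Gam x j)^T) u *+ 2 = (- rho x * x 0 j * dot u u) *+ 2.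
  by rewrite mulr2n {1}h1 h2; ring.
by move/eqP; rewrite eqrMn2r// => /eqP.
Qed.

Lemma isD_sqnorm x j : is_derive x (delta_mx 0 j) sqnorm (2 * bvec x 0 j).
Proof.
have r0 := rho_neq0 x.
have hu := mxD_uvec S x j.
have h : is_derive x (delta_mx 0 j) sqnorm _ :=
  isD_mul (isD_rhoV2 x j) (mxD_mul hu (mxD_tr hu) 0 0).
apply: (is_derive_eq h).
set v := _ + _ *m (Gam x j)^T.
have -> : (v *m (uvec S x)^T + uvec S x *m v^T) 0 0 = 2 * dot v (uvec S x).
  by rewrite mxE -/(dot _ _) -/(dot _ _) [dot (uvec S x) v]dotC; ring.
rewrite /v dotDl dot_mul_Gam.
have -> : dot (delta_mx 0 j *m Nmx S x) (uvec S x) = (uvec S x *m Nmx S x) 0 j.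
  by rewrite /dot -mulmxA -(tr_Nmx symS) -trmx_mul deltaE mxE eqxx mulr1n (tr_Nmx symS).
have -> : bvec x 0 j = rho x ^- 2 * (uvec S x *m Nmx S x) 0 j by rewrite mxE.
rewrite -/(dot (uvec S x) (uvec S x)); by field.
Qed.

Definition dN x i : 'M[R]_n :=
  Gam x i *m Nmx S x + Nmx S x *m (Gam x i)^T
   - rho x ^+ 2 *: ((delta_mx 0 i)^T *m uvec S x + (uvec S x)^T *m delta_mx 0 i
                    + (2 * uvec S x 0 i)%:M).

Definition du x i : 'rV[R]_n := delta_mx 0 i *m Nmx S x + uvec S x *m (Gam x i)^T.

Lemma mxD_bvec x i : mxD bvec x (delta_mx 0 i)
  ((2 * x 0 i / rho x) *: (uvec S x *m Nmx S x)
   + rho x ^- 2 *: (du x i *m Nmx S x + uvec S x *m dN x i)).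
Proof.
exact: mxD_scale (isD_rhoV2 x i) (mxD_mul (mxD_uvec S x i) (mxD_Nmx symS x i)).
Qed.

(** The inverse metric is a scalar matrix, so only entries whose first index is the direction of
    differentiation occur. The second connection term is rewritten with [Gam x k] because it will
    cancel against the fibre derivative in [isD_kk_form]. *)
Lemma dN_entry x i k : dN x i i k = (Gam x i *m Nmx S x) i k + (Gam x k *m Nmx S x) i i
  - rho x ^+ 2 * (uvec S x 0 k + 3 * uvec S x 0 i * (i == k)%:R).
Proof.
have -> : (Gam x k *m Nmx S x) i i = (Nmx S x *m (Gam x i)^T) i k.
  rewrite !mxE; apply: eq_bigr => l _; rewrite [(_^T) l k]mxE Gam_sym mulrC.
  by rewrite -{1}(tr_Nmx symS) mxE.
rewrite /dN [in LHS]mxE [in X in X + _]mxE; congr (_ + _).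
rewrite !mxE !big_ord1 !mxE !eqxx (eq_sym k i); case: (i == k) => /=; ring.
Qed.

Lemma du_entry x i k : du x i 0 k = Nmx S x i k + (uvec S x *m (Gam x k)^T) 0 i.
Proof.
rewrite /du mxE -rowE mxE; congr (_ + _); rewrite [LHS]mxE [RHS]mxE.
by apply: eq_bigr => l _; congr (_ * _); rewrite [LHS]mxE [RHS]mxE Gam_sym.
Qed.

(** Summed over [i], the terms without [Gam] are Bochner's formula: up to the factor rho^2, Lap F =
    |nabla sigma|^2 + <Lap(sigma), sigma> for F = |sigma|^2/2. *)
Lemma dbvec_entry x i :
  ((2 * x 0 i / rho x) *: (uvec S x *m Nmx S x)
   + rho x ^- 2 *: (du x i *m Nmx S x + uvec S x *m dN x i)) 0 i
  = (bvec x *m (Gam x i)^T) 0 i + rho x ^- 2 * (Nmx S x *m Nmx S x) i i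
    - (3 * uvec S x 0 i ^+ 2 + dot (uvec S x) (uvec S x)).
Proof.
have r0 := rho_neq0 x.
have key (u : 'rV[R]_n) (N G : 'M[R]_n) (c r : R) : G^T = - G - c%:M ->
    (delta_mx 0 i *m N + u *m G^T) *m N
    + u *m (G *m N + N *m G^T
            - r *: ((delta_mx 0 i)^T *m u + u^T *m delta_mx 0 i + (2 * u 0 i)%:M)) =
    delta_mx 0 i *m (N *m N) + u *m N *m G^T - c *: (u *m N)
    - r *: (u 0 i *: u + dot u u *: delta_mx 0 i + (2 * u 0 i) *: u).
  move=> GT; rewrite mulmxDl {1}GT !mulmxBr mulmxN mulmxBl mulNmx.
  rewrite mul_mx_scalar -scalemxAl -scalemxAr !mulmxDr mul_mx_scalar !mulmxA !dotE.
  rewrite [dot u (delta_mx 0 i)]dotC dot_delta !mul_scalar_mx.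
  by apply/rowP => k; rewrite !mxE; ring.
rewrite (key _ _ _ _ _ (tr_Gam x i)) /bvec -scalemxAl.
have -> : (Nmx S x *m Nmx S x) i i =
    ((delta_mx 0 i : 'rV_n) *m (Nmx S x *m Nmx S x)) 0 i.
  by rewrite -rowE [RHS]mxE.
move: (uvec S x) (Nmx S x) (Gam x i) => u N G.
move: (delta_mx 0 i *m (N *m N)) (u *m N *m G^T) (u *m N) (dot u u) => v w z d.
by rewrite !(mxE, eqxx) /=; field.
Qed.

End QuadraticSection.

(** * The fibre components of the tension field *)

Section VerticalTension.
Context {R : realType} {n : nat}.
Variable S : 'M[R]_n.+1.
Hypothesis symS : S^T = S.
Variables B C : R -> R.
Hypotheses (dB : forall t, derivable B t 1) (dC : forall t, derivable C t 1).
Implicit Types (x y : 'rV[R]_n) (z w : 'rV[R]_(n + n)).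

Let kk := kk_metric (@conf_metric R n) (cst 1) B C.

Lemma dot_uvec x i : dot (delta_mx 0 i *m Nmx S x) (svec S x) = bvec S x 0 i.
Proof.
rewrite /svec /bvec dotZr [RHS]mxE; congr (_ * _).
by rewrite /dot -mulmxA -[in LHS](tr_Nmx symS) -trmx_mul deltaE mxE eqxx mulr1n.
Qed.

Lemma rho2_svec x (v : 'rV[R]_n) : rho x ^+ 2 * dot v (svec S x) = dot v (uvec S x).
Proof. by rewrite /svec dotZr mulrA divff ?mul1r// expf_neq0// rho_neq0. Qed.

Lemma vpart_rshift z k : vpart (@conf_metric R n) z (delta_mx 0 (rshift n k)) = delta_mx 0 k.
Proof. by rewrite delta_mx_rshift; exact: vpart_vlift. Qed.

Lemma lsubmx_rshift k :
  lsubmx (delta_mx 0 (rshift n k) : 'rV[R]_(n + n)) = 0.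
Proof. by rewrite delta_mx_rshift row_mxKl. Qed.

Lemma rsubmx_rshift k :
  rsubmx (delta_mx 0 (rshift n k) : 'rV[R]_(n + n)) = delta_mx 0 k.
Proof. by rewrite delta_mx_rshift row_mxKr. Qed.

Lemma partial_sect y j a : partial j (fun y' => sect S y' 0 a) y = dsect S y j 0 a.
Proof. by case: (mxD_sect S y j 0 a). Qed.

Lemma kk_dsect y j k :
  \sum_a kk (sect S y) (rshift n k) a * partial j (fun y' => sect S y' 0 a) y =
  B (sqnorm S y) * Nmx S y j k + C (sqnorm S y) * bvec S y 0 j * uvec S y 0 k.
Proof.
under eq_bigr => a _ do rewrite partial_sect.
rewrite kk_metric_mulr kk_formE vpart_dsect vpart_rshift lsubmx_rshift.
have r2 : rho y ^+ 2 != 0 by rewrite expf_neq0// rho_neq0.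
rewrite /sect row_mxKl row_mxKr -sqnormE dot0l mulr0 add0r.
have -> : dot (delta_mx 0 k) (rho y ^- 2 *: (delta_mx 0 j *m Nmx S y)) =
    rho y ^- 2 * Nmx S y j k by rewrite dotZr dotC dot_mulr_delta.
rewrite rho2_svec dot_delta [dot (_ *: _) _]dotZl dot_uvec.
by rewrite !(mulrA (rho y ^+ 2)) divff// !mul1r mulrAC.
Qed.

Lemma isD_lsubmx (f : 'rV[R]_n -> R) z k :
  differentiable f (lsubmx z) ->
  is_derive z (delta_mx 0 (rshift n k)) (fun z => f (lsubmx z)) 0.
Proof.
move=> df; have hl : mxD (fun z : 'rV[R]_(n + n) => lsubmx z) z (delta_mx 0 (rshift n k))
    (lsubmx (delta_mx 0 (rshift n k))).
  by move=> i j; rewrite mxE; under eq_fun do rewrite mxE; exact: mxD_id.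
apply: (is_derive_eq (isD_chain df hl)); rewrite lsubmx_rshift big1// => i _.
by rewrite mxE mul0r.
Qed.

(** The tangent vector [dsect S x i] stays frozen while the base point moves along the fibre; this
    is the derivative of the target metric that [lowered_tension] requires for a vertical index. *)
Lemma isD_kk_form x i k :
  is_derive (sect S x) (delta_mx 0 (rshift n k))
    (fun z => kk_form (@conf_metric R n) (cst 1) B C z (dsect S x i) (dsect S x i))
    (2 * (B^`()%classic (sqnorm S x) * uvec S x 0 k * (rho x ^- 2 * (Nmx S x *m Nmx S x) i i)
     + B (sqnorm S x) * (Gam x k *m Nmx S x) i i
     + C^`()%classic (sqnorm S x) * uvec S x 0 k * bvec S x 0 i ^+ 2
     + C (sqnorm S x) * bvec S x 0 i * ((uvec S x *m (Gam x k)^T) 0 i + Nmx S x i k))).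
Proof.
have r0 := rho_neq0 x.
set z := sect S x; set v := delta_mx 0 (rshift n k); set w := dsect S x i.
have lz : lsubmx z = x by exact: row_mxKl.
have rz : rsubmx z = svec S x by exact: row_mxKr.
have hr : is_derive z v (fun z => rho (lsubmx z)) 0.
  by apply: isD_lsubmx; exact: df_rho (mxdf_id _).
have hr2 := isD_mul hr hr.
have he : mxD (fun z : 'rV[R]_(n + n) => rsubmx z) z v (delta_mx 0 k).
  move=> a b; rewrite -rsubmx_rshift mxE; under eq_fun do rewrite mxE.
  exact: mxD_id.
have hG : mxD (fun z => Gam (lsubmx z) i) z v 0.
  move=> a b; rewrite mxE; apply: (@isD_lsubmx (fun y => Gam y i a b)).
  exact: (mxdf_Gam i (mxdf_id _) a b).
have hv : mxD (fun z => vpart (@conf_metric R n) z w) z v (delta_mx 0 k *m Gam x i).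
  have -> : (fun z => vpart (@conf_metric R n) z w) =
      (fun z => rsubmx w + rsubmx z *m Gam (lsubmx z) i).
    apply/funext => z'; rewrite /vpart; congr (_ + _).
    by rewrite /w /dsect row_mxKl christoffel_app_delta.
  apply: (mxD_eq (mxD_add (mxD_cst (rsubmx w) z v) (mxD_mul he hG))).
  by rewrite mulmx0 addr0 add0r lz.
have ht := isD_mul hr2 (isD_dot2 he he).
have hB := isD_comp dB ht.
have hC := isD_comp dC ht.
have h1 := isD_mul hr2 (isD_cst z v (dot (lsubmx w) (lsubmx w))).
have h2 := isD_mul hB (isD_mul hr2 (isD_dot2 hv hv)).
have h3 := isD_mul (isD_mul hC (isD_mul hr2 (isD_dot2 hv he))) (isD_mul hr2 (isD_dot2 hv he)).
under eq_fun do rewrite kk_formE.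
apply: (is_derive_eq (isD_add (isD_add h1 h2) h3)).
rewrite vpart_dsect lz rz -expr2 -sqnormE.
set B0 := B _; set B1 := _ (sqnorm S x); set C0 := C _; set C1 := _ (sqnorm S x).
have GE : (delta_mx 0 k : 'rV_n) *m Gam x i = delta_mx 0 i *m Gam x k.
  by apply/rowP => l; rewrite -!rowE [LHS]mxE [RHS]mxE Gam_sym.
have -> : dot (rho x ^- 2 *: (delta_mx 0 i *m Nmx S x)) (rho x ^- 2 *: (delta_mx 0 i *m Nmx S x))
    = rho x ^- 2 * (rho x ^- 2 * (Nmx S x *m Nmx S x) i i).
  by rewrite dotZl dotZr dot_rows (tr_Nmx symS).
have E3 : dot (delta_mx 0 k *m Gam x i) (rho x ^- 2 *: (delta_mx 0 i *m Nmx S x))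
    = rho x ^- 2 * (Gam x k *m Nmx S x) i i.
  by rewrite GE dotZr dot_rows (tr_Nmx symS).
rewrite [dot (_ *: _) (delta_mx 0 k *m _)]dotC E3.
have -> : dot (rho x ^- 2 *: (delta_mx 0 i *m Nmx S x)) (svec S x) = rho x ^- 2 * bvec S x 0 i.
  by rewrite dotZl dot_uvec.
have -> : dot (rho x ^- 2 *: (delta_mx 0 i *m Nmx S x)) (delta_mx 0 k) = rho x ^- 2 * Nmx S x i k.
  by rewrite dotZl dot_mulr_delta.
have -> : dot (delta_mx 0 k *m Gam x i) (svec S x) = rho x ^- 2 * (uvec S x *m (Gam x k)^T) 0 i.
  rewrite GE /svec dotZr; congr (_ * _); rewrite dotC /dot trmx_mul mulmxA.
  by rewrite trmx_delta -colE mxE.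
rewrite [dot (svec S x) (delta_mx 0 k)]dotC.
have -> : dot (delta_mx 0 k) (svec S x) = rho x ^- 2 * uvec S x 0 k.
  by rewrite dot_delta mxE.
by field.
Qed.

Lemma derivable_dsect x i j a :
  derivable (fun y => partial j (fun y' => sect S y' 0 a) y) x (delta_mx 0 i).
Proof.
have -> : (fun y => partial j (fun y' => sect S y' 0 a) y) = (fun y => dsect S y j 0 a).
  by apply/funext => y; rewrite partial_sect.
pose v : 'rV[R]_n := delta_mx 0 i.
have hG : mxD (fun y => Gam y j) x v (\matrix_(b, c) 'D_v (fun y => Gam y j b c) x).
  move=> b c; rewrite mxE; apply: derivableP; apply: diff_derivable.
  exact: (mxdf_Gam j (mxdf_id _)).
have h := mxD_row (mxD_cst (delta_mx 0 j : 'rV[R]_n) x v) (mxD_add (mxD_scale (isD_rhoV2 x i)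
  (mxD_mul (mxD_cst (delta_mx 0 j : 'rV[R]_n) x v) (mxD_Nmx symS x i)))
  (mxD_opp (mxD_mul (mxD_svec S x i) hG))).
by case: (h 0 a).
Qed.

(* [rho^2] times the [g]-inner product with [X_k] of
   [B Lap sigma + 2 B' nabla_(grad F) sigma
    + (C <Lap sigma, sigma> + C' |grad F|^2 + (C - B') |nabla sigma|^2) sigma],
   where [F = |sigma|^2 / 2], [Lap sigma = - (n + 3) sigma] and [bvec = dF]. *)
Definition el_vert x k : R :=
  - (n%:R + 3) * B (sqnorm S x) * rho x ^+ 2 * uvec S x 0 k
  + 2 * B^`()%classic (sqnorm S x) * (bvec S x *m Nmx S x) 0 k
  - B^`()%classic (sqnorm S x) * uvec S x 0 k * (rho x ^- 2 * \tr (Nmx S x *m Nmx S x))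
  + C^`()%classic (sqnorm S x) * uvec S x 0 k * dot (bvec S x) (bvec S x)
  + C (sqnorm S x) * uvec S x 0 k * (rho x ^- 2 * \tr (Nmx S x *m Nmx S x)
       - (n%:R + 3) * dot (uvec S x) (uvec S x)).

(** The three terms of [lowered_tension] are computed as [HE] (derivative of the lowered
    differential), [GE] (connection of the sphere) and [LE] (fibre derivative of the metric). *)
Lemma el_vertE x k : kk (sect S x) \in unitmx ->
  \sum_a kk (sect S x) (rshift n k) a * tension (@conf_metric R n) kk (sect S) x 0 a
  = rho x ^- 2 * el_vert x k.
Proof.
move=> hu; have r0 := rho_neq0 x.
have DE i : (\row_a partial i (fun y => sect S y 0 a) x) = dsect S x i.
  by apply/rowP => a; rewrite mxE partial_sect.
have gs i j : invmx (@conf_metric R n x) i j = invmx (@conf_metric R n x) j i.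
  by rewrite invmx_conf !mxE eq_sym.
have hs z a b : kk z a b = kk z b a by exact: kk_metric_sym.
have hd a b : differentiable (fun z => kk z a b) (sect S x).
  by under eq_fun do rewrite /kk mxE; exact: df_kk_form.
have dF i : mxD (sect S) x (delta_mx 0 i) (\row_a partial i (fun y => sect S y 0 a) x).
  by rewrite DE; exact: mxD_sect.
rewrite (lowered_tension gs hs hu hd dF (@derivable_dsect x) (rshift n k)).
set u := uvec S x; set N := Nmx S x; set b := bvec S x.
set B0 := B (sqnorm S x); set B1 := B^`()%classic (sqnorm S x).
set C0 := C (sqnorm S x); set C1 := C^`()%classic (sqnorm S x).
have HE i : partial i (fun y => \sum_a kk (sect S y) (rshift n k) a *
      partial i (fun y' => sect S y' 0 a) y) x
    = 2 * B1 * b 0 i * N i k + B0 * dN S x i i k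
      + (2 * C1 * b 0 i ^+ 2 + C0 * ((b *m (Gam x i)^T) 0 i + rho x ^- 2 * (N *m N) i i
           - (3 * u 0 i ^+ 2 + dot u u))) * u 0 k
      + C0 * b 0 i * (N i k + (u *m (Gam x k)^T) 0 i).
  under [fun y => \sum_a _]eq_fun do rewrite kk_dsect.
  have hB := isD_comp dB (isD_sqnorm symS x i).
  have hC := isD_comp dC (isD_sqnorm symS x i).
  have h := isD_add (isD_mul hB (mxD_Nmx symS x i i k))
    (isD_mul (isD_mul hC (mxD_bvec symS x i 0 i)) (mxD_uvec S x i 0 k)).
  rewrite /partial; case: h => _ ->.
  rewrite dbvec_entry// -/(du S x i) du_entry -/(dN S x i) -/B0 -/B1 -/C0 -/C1 -/u -/N -/b; ring.
have GE i : \sum_l christoffel (@conf_metric R n) l i i x * (\sum_a kk (sect S x) (rshift n k) a *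
      partial l (fun y' => sect S y' 0 a) x)
    = B0 * (Gam x i *m N) i k + C0 * u 0 k * (b *m (Gam x i)^T) 0 i.
  rewrite [(Gam x i *m N) i k]mxE [(b *m _) 0 i]mxE !mulr_sumr -big_split/=.
  apply: eq_bigr => l _; rewrite kk_dsect christoffel_conf [(_^T) l i]mxE.
  by rewrite -/B0 -/C0 -/u -/N -/b; ring.
have LE i : \sum_b0 \sum_c partial (rshift n k) (fun z => kk z b0 c) (sect S x) *
      partial i (fun y => sect S y 0 b0) x * partial i (fun y => sect S y 0 c) x
    = 2 * (B1 * u 0 k * (rho x ^- 2 * (N *m N) i i) + B0 * (Gam x k *m N) i i
     + C1 * u 0 k * b 0 i ^+ 2 + C0 * b 0 i * ((u *m (Gam x k)^T) 0 i + N i k)).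
  have h2 := isD_kk_form x i k.
  set w := dsect S x i in h2.
  have h1 : is_derive (sect S x) (delta_mx 0 (rshift n k))
      (fun z => \sum_b0 \sum_c kk z b0 c * w 0 b0 * w 0 c)
      (\sum_b0 \sum_c partial (rshift n k) (fun z => kk z b0 c) (sect S x) * w 0 b0 * w 0 c).
    apply: isD_sum => b0; apply: isD_sum => c.
    have hk : is_derive (sect S x) (delta_mx 0 (rshift n k)) (fun z => kk z b0 c)
        (partial (rshift n k) (fun z => kk z b0 c) (sect S x)).
      by apply: derivableP; apply: diff_derivable.
    apply: (is_derive_eq (isD_mul (isD_mul hk (isD_cst _ _ (w 0 b0))) (isD_cst _ _ (w 0 c)))).
    ring.
  have FE : (fun z => kk_form (@conf_metric R n) (cst 1) B C z w w) =
      (fun z => \sum_b0 \sum_c kk z b0 c * w 0 b0 * w 0 c).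
    apply/funext => z; rewrite -kk_metric_ip /ip -mulmxA mxE; apply: eq_bigr => b0 _.
    rewrite [X in _ * X]mxE mulr_sumr; apply: eq_bigr => c _.
    by rewrite [(_^T) c 0]mxE /kk; ring.
  rewrite FE in h2.
  case: h1 => _ h1; case: h2 => _ h2; rewrite -h2 h1.
  by apply: eq_bigr => b0 _; apply: eq_bigr => c _; rewrite !partial_sect.
(* What remains once every [Gam] term of [HE] has cancelled against [GE] and [LE]. *)
pose term i := 2 * B1 * b 0 i * N i k - B0 * rho x ^+ 2 * (u 0 k + 3 * u 0 i * (i == k)%:R)
  + C1 * u 0 k * b 0 i ^+ 2 + C0 * u 0 k * (rho x ^- 2 * (N *m N) i i
        - 3 * u 0 i ^+ 2 - dot u u) - B1 * u 0 k * (rho x ^- 2 * (N *m N) i i).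
rewrite (eq_bigr (fun i => rho x ^- 2 * term i)) => [|i _]; last first.
  rewrite (bigD1 i)//= [X in _ + X]big1 => [|j ji]; last first.
    by rewrite invmx_conf mxE eq_sym (negPf ji) mulr0n mul0r.
  rewrite invmx_conf mxE eqxx mulr1n addr0 HE GE LE dN_entry// -/u -/N /term.
  by congr (_ * _); field.
rewrite -mulr_sumr; congr (_ * _).
have bN : \sum_i b 0 i * N i k = (b *m N) 0 k by rewrite [RHS]mxE.
have sq (v : 'rV[R]_n) : \sum_i v 0 i * v 0 i = dot v v.
  by rewrite /dot mxE; apply: eq_bigr => i _; rewrite [(_^T) i 0]mxE.
have uk : \sum_i u 0 i * (i == k)%:R = u 0 k.
  rewrite (bigD1 k)//= big1 => [|j jk]; last by rewrite (negPf jk) mulr0.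
  by rewrite eqxx mulr1 addr0.
have s1 : \sum_(i < n) (1 : R) = n%:R by rewrite sumr_const card_ord.
rewrite (eq_bigr (fun i => 2 * B1 * (b 0 i * N i k)
    + (- B0 * rho x ^+ 2 * u 0 k - C0 * u 0 k * dot u u) * 1
    + (- 3 * B0 * rho x ^+ 2) * (u 0 i * (i == k)%:R)
    + C1 * u 0 k * (b 0 i * b 0 i)
    + (C0 * u 0 k * rho x ^- 2 - B1 * u 0 k * rho x ^- 2) * (N *m N) i i
    + (- 3 * C0 * u 0 k) * (u 0 i * u 0 i))); last by move=> i _; rewrite /term; ring.
rewrite !big_split/= -!mulr_sumr bN !sq uk s1 -/(\tr (N *m N)) /el_vert.
by rewrite -/B0 -/B1 -/C0 -/C1 -/u -/N -/b; ring.
Qed.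

(** If the tension is orthogonal to all vertical basis vectors, it is orthogonal to the lift of its
    own vertical part [v]. Horizontal and vertical spaces being orthogonal, that lift has norm zero,
    and positivity gives [v = 0]. *)
Lemma vpart_tension_eq0 x : posdef (kk (sect S x)) ->
  vpart (@conf_metric R n) (sect S x) (tension (@conf_metric R n) kk (sect S) x) = 0 <->
  forall k, el_vert x k = 0.
Proof.
move=> pd; have hu := posdef_unitmx pd.
set tau := tension _ _ _ _; set v := vpart _ _ tau.
have r0 : rho x ^- 2 != 0 by rewrite invr_neq0// expf_neq0// rho_neq0.
have elE k : el_vert x k = rho x ^+ 2 * kk_form (@conf_metric R n) (cst 1) B C (sect S x)
    (delta_mx 0 (rshift n k)) tau.
  by rewrite -kk_metric_mulr el_vertE// mulrA divff ?mul1r// expf_neq0// rho_neq0.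
split=> [v0 k|h].
  by rewrite elE kk_formE -/v v0 lsubmx_rshift dot0l [dot _ 0]dotC !dot0l !mulr0 !addr0 mulr0.
have hv0 : kk_form (@conf_metric R n) (cst 1) B C (sect S x) (vlift v) tau = 0.
  rewrite kk_formC [vlift v]row_sum_delta kk_form_sumr big_split_ord/=.
  rewrite big1 => [|i _]; last by rewrite row_mxEl mxE mul0r.
  rewrite add0r big1// => i _; rewrite kk_formC.
  have /eqP := elE i; rewrite h eq_sym mulf_eq0 expf_eq0/= (negPf (rho_neq0 x)) /=.
  by move=> /eqP ->; rewrite mulr0.
have vv : kk_form (@conf_metric R n) (cst 1) B C (sect S x) (vlift v) (vlift v) = 0.
  have lv : lsubmx (vlift v) = 0 by exact: row_mxKl.
  by rewrite -hv0 !kk_formE vpart_vlift -/v lv !dot0l.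
apply/eqP/negPn/negP => v0.
have : vlift v != 0.
  apply: contraNneq v0 => /(congr1 (@rsubmx R 1 n n)); rewrite /vlift row_mxKr => ->.
  by rewrite linear0.
by move=> /pd; rewrite kk_metric_ip vv ltxx.
Qed.

End VerticalTension.

(** * Spectral theorem for real symmetric matrices *)

Section Spectral.
Context {R : realType}.

(** The reflection that exchanges the first basis vector and [p]. It serves twice: to centre a chart
    at [p], and to split off an eigenvector in the diagonalization. *)
Lemma householder m (p : 'rV[R]_m.+1) : dot p p = 1 ->
  exists Q : 'M[R]_m.+1, Q *m Q^T = 1%:M /\ delta_mx 0 0 *m Q = p.
Proof.
move=> pp; pose e : 'rV[R]_m.+1 := delta_mx 0 0; pose w := e - p.
have ee : dot e e = 1 by rewrite dot_delta mxE !eqxx.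
have [w0|w0] := eqVneq w 0.
  exists 1%:M; rewrite trmx1 !mulmx1; split=> //.
  by apply/eqP; rewrite -subr_eq0 -/e -/w w0.
have ww0 : dot w w != 0 by rewrite dot_eq0.
have wwE : dot w w = 2 - 2 * dot e p.
  rewrite /w dotDl !dotDr !dotNl ![dot _ (- p)]dotC !dotNl ee pp [dot p e]dotC; ring.
have ewE : dot e w = 1 - dot e p by rewrite /w dotDr ee [dot _ (- p)]dotC dotNl dotC.
pose c := 2 / dot w w.
exists (1%:M - c *: (w^T *m w)).
have tH : (1%:M - c *: (w^T *m w))^T = 1%:M - c *: (w^T *m w).
  by rewrite linearB/= trmx1 linearZ/= trmx_mul trmxK.
split.
  have XX : (w^T *m w) *m (w^T *m w) = dot w w *: (w^T *m w).
    by rewrite -mulmxA [w *m (_ *m _)]mulmxA dotE mul_scalar_mx -scalemxAr.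
  rewrite tH mulmxBr mulmx1 mulmxBl mul1mx -scalemxAl -scalemxAr XX /c.
  move: (w^T *m w) => X; apply/matrixP => i j; rewrite !mxE; by field.
rewrite mulmxBr mulmx1 -scalemxAr mulmxA dotE mul_scalar_mx scalerA -/e.
have -> : c * dot e w = 1 by rewrite /c; move: ww0; rewrite wwE ewE => h; field.
by rewrite scale1r /w opprB addrC subrK.
Qed.

Lemma df_quad m (S : 'M[R]_m) (v : 'rV[R]_m) : differentiable (fun v => dot (v *m S) v) v.
Proof. exact: df_dot (mxdf_mul (mxdf_id v) (mxdf_cst S v)) (mxdf_id v). Qed.

Lemma compact_unit_sphere m : compact [set v : 'rV[R]_m | dot v v = 1].
Proof.
apply: bounded_closed_compact.
  exists 1; split; first exact: num_real.
  move=> M M1 v /= vv; rewrite [leLHS]/Num.Def.normr/= mx_normrE.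
  apply: bigmax_le => [|[i j] _ /=]; first by rewrite (le_trans ler01)// ltW.
  rewrite (le_trans _ (ltW M1))// -(@ler_pXn2r _ 2)// ?nnegrE//.
  rewrite expr1n real_normK ?num_real// -vv /dot mxE (bigD1 j)//= mxE ord1 expr2.
  by rewrite lerDl sumr_ge0// => k _; rewrite mxE -expr2 sqr_ge0.
have cont : continuous (fun v : 'rV[R]_m => dot v v).
  by move=> v; apply: differentiable_continuous; exact: df_dot (mxdf_id v) (mxdf_id v).
have -> : [set v : 'rV[R]_m | dot v v = 1] = (fun v => dot v v) @^-1` [set 1] by [].
by apply: (continuous_closedP _).1 => //; exact: closed_eq.
Qed.

(* A maximum [p] of the quadratic form on the sphere makes the form
   [v (a - S) v^T] nonnegative and null at [p], hence [p (a - S) = 0]. *)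
Lemma symmetric_eigenvector m (S : 'M[R]_m.+1) : S^T = S ->
  exists (p : 'rV[R]_m.+1) a, dot p p = 1 /\ p *m S = a *: p.
Proof.
move=> symS.
have A0 : [set v : 'rV[R]_m.+1 | dot v v = 1] !=set0.
  by exists (delta_mx 0 0); rewrite /= dot_delta mxE !eqxx.
have cont : continuous (fun v : 'rV[R]_m.+1 => dot (v *m S) v).
  by move=> v; apply: differentiable_continuous; exact: df_quad.
have [p] := EVT_max_rV A0 (@compact_unit_sphere m.+1) (continuous_subspaceT cont).
rewrite inE/= => pp pmax; pose a := dot (p *m S) p; exists p, a; split=> //.
pose f (v : 'rV[R]_m.+1) := a * dot v v - dot (v *m S) v.
have f_ge0 v : 0 <= f v.
  have [->|v0] := eqVneq v 0; first by rewrite /f mul0mx !dot0l mulr0 subr0.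
  have vv0 : 0 < dot v v by rewrite lt_neqAle eq_sym dot_eq0 v0 dot_ge0.
  pose s := Num.sqrt (dot v v).
  have s0 : s != 0 by rewrite gt_eqF// sqrtr_gt0.
  have ss : s * s = dot v v by rewrite -expr2 sqr_sqrtr// ltW.
  have u1 : dot (s^-1 *: v) (s^-1 *: v) = 1 by rewrite dotZl dotZr -ss; field.
  have := pmax (s^-1 *: v); rewrite inE/= => /(_ u1).
  rewrite -/a -scalemxAl dotZl dotZr => h; rewrite subr_ge0.
  have -> : dot (v *m S) v = s * s * (s^-1 * (s^-1 * dot (v *m S) v)) by field.
  by rewrite ss mulrC ler_wpM2r// ltW.
pose w := a *: p - p *m S.
have pw : f p = 0 by rewrite /f pp mulr1 subrr.
have expandv (c : R) v : f (p + c *: v) = c * (2 * (a * dot p v - dot (p *m S) v) + c * f v).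
  have sym : dot (v *m S) p = dot (p *m S) v.
    by rewrite dotC /dot trmx_mul symS mulmxA.
  rewrite /f mulmxDl -scalemxAl !dotDl !dotDr !dotZl !dotZr sym [dot v p]dotC.
  by rewrite pp -/a; ring.
have expand (c : R) : f (p + c *: w) = c * (2 * dot w w + c * f w).
  by rewrite expandv [in RHS]/w dotDl dotNl dotZl.
have ww : dot w w = 0.
  apply/eqP; rewrite eq_le dot_ge0 andbT leNgt; apply/negP => w0.
  have F0 := f_ge0 w.
  (* A negative [c] so small that 2|w|^2 + c f(w) stays positive makes f(p + c w) negative; the
     [+ 1] keeps the denominator positive when f(w) = 0. *)
  pose c := - dot w w / (f w + 1).
  have F1 : 0 < f w + 1 by rewrite ltr_wpDl.
  have c0 : c < 0 by rewrite /c mulNr oppr_lt0 divr_gt0.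
  have := f_ge0 (p + c *: w); rewrite expand nmulr_rge0// leNgt => /negP; apply.
  have -> : 2 * dot w w + c * f w = dot w w * (f w + 2) / (f w + 1).
    by rewrite /c; field; rewrite gt_eqF.
  by rewrite divr_gt0// mulr_gt0// ltr_wpDl.
by move/eqP: ww; rewrite dot_eq0 subr_eq0 => /eqP ->.
Qed.

(** Induction on the size: a Householder matrix moves an eigenvector to the first basis vector, and
    symmetry then makes the conjugate of [S] block diagonal. *)
Lemma symmetric_diagonalization m (S : 'M[R]_m) : S^T = S ->
  exists (P : 'M[R]_m) (d : 'rV[R]_m), P *m P^T = 1%:M /\ P *m S *m P^T = diag_mx d.
Proof.
elim: m S => [|m IH] S symS.
  by exists 1%:M, 0; rewrite [1%:M]flatmx0 [_ *m _]flatmx0 [diag_mx _]flatmx0 [_ *m _]flatmx0.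
have [p [a [pp pS]]] := symmetric_eigenvector symS.
have [H [HH Hp]] := householder pp.
pose T : 'M[R]_(1 + m) := H *m S *m H^T.
have symT : T^T = T by rewrite /T !trmx_mul trmxK symS mulmxA.
have rT : (delta_mx 0 0 : 'rV_m.+1) *m (H *m S *m H^T) = a *: delta_mx 0 0.
  by rewrite !mulmxA Hp pS -scalemxAl -Hp -mulmxA HH mulmx1.
have TE i : T 0 i = a *+ (i == 0).
  have := congr1 (fun M : 'rV[R]_m.+1 => M 0 i) rT.
  rewrite -rowE [LHS]mxE [RHS]mxE [in RHS]mxE eqxx /= => E.
  by rewrite -[LHS]/((H *m S *m H^T) 0 i) E mulr_natr.
have TlE (i : 'I_1) k : T (lshift m i) k = a *+ (k == 0).
  by rewrite -TE; congr (T _ _); apply/val_inj; rewrite /= ord1.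
have uT : ursubmx T = 0 by apply/matrixP => i j; rewrite [LHS]mxE [LHS]mxE TlE mxE.
have T00 : ulsubmx T = a%:M.
  by apply/matrixP => i j; rewrite [LHS]mxE [LHS]mxE TlE mxE !ord1.
have lT : dlsubmx T = 0 by rewrite -symT -trmx_ursub uT trmx0.
have symD : (drsubmx T)^T = drsubmx T by rewrite trmx_drsub symT.
have [P [d [PP PD]]] := IH _ symD.
pose P1 : 'M[R]_(1 + m) := block_mx 1%:M 0 0 P.
exists (P1 *m H), (row_mx a%:M d : 'rV_(1 + m)).
have P1P : P1 *m P1^T = 1%:M.
  rewrite /P1 tr_block_mx !trmx0 trmx1 mulmx_block !mulmx0 !mul0mx !addr0 add0r.
  by rewrite mulmx1 PP -scalar_mx_block.
split; first by rewrite trmx_mul mulmxA -[P1 *m H *m _]mulmxA HH mulmx1.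
have -> : P1 *m H *m S *m (P1 *m H)^T = P1 *m T *m P1^T.
  by rewrite trmx_mul /T !mulmxA.
rewrite -[T]submxK uT T00 lT /P1 tr_block_mx !trmx0 trmx1 !mulmx_block.
rewrite !(mulmx0, mul0mx, addr0, add0r) mul1mx mulmx1 PD.
have E : diag_mx (row_mx a%:M d : 'rV[R]_(1 + m)) = block_mx a%:M 0 0 (diag_mx d).
  by rewrite diag_mx_row; congr block_mx; apply/matrixP => i j; rewrite !mxE !ord1.
exact: esym E.
Qed.

Lemma mxrank_diag m (d : 'rV[R]_m) : \rank (diag_mx d) = #|[set i | d 0 i != 0]%SET|.
Proof.
have -> : \rank (diag_mx d) =
    \rank (\sum_(i | d 0 i != 0) <<delta_mx 0 i : 'rV[R]_m>>)%MS.
  apply: eqmx_rank; apply/andP; split.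
    apply/row_subP => i; have -> : row i (diag_mx d) = d 0 i *: delta_mx 0 i.
      apply/rowP => j; rewrite !mxE eqxx /= (eq_sym j i).
      by case: (eqVneq i j) => [->|_]; rewrite ?mulr1n ?mulr0n ?mulr1 ?mulr0.
    have [->|di] := eqVneq (d 0 i) 0; first by rewrite scale0r sub0mx.
    by rewrite scalemx_sub// (sumsmx_sup i)// genmxE.
  apply/sumsmx_subP => i di; rewrite genmxE.
  have -> : delta_mx 0 i = (d 0 i)^-1 *: row i (diag_mx d) :> 'rV_m.
    apply/rowP => j; rewrite !mxE eqxx /= (eq_sym j i).
    by case: (i == j); rewrite ?mulr1n ?mulr0n ?mulr0 ?mulVf.
  by rewrite scalemx_sub// row_sub.
have inj : {in (fun i => d 0 i != 0) &, injective (@id 'I_m)} by [].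
have /mxdirectP h := mxdirect_delta R inj.
rewrite h /= (eq_bigr (fun=> 1%N)) => [|i _]; last by rewrite mxrank_gen mxrank_delta.
by rewrite sum1dep_card.
Qed.

(** Turns the multiplicities of [two_eigenvalues] into cardinalities: conjugation by [P] preserves
    the rank, and the rank of a diagonal matrix counts its nonzero entries. *)
Lemma rank_eigenspace m (S P : 'M[R]_m) (d : 'rV[R]_m) a :
  P *m P^T = 1%:M -> P *m S *m P^T = diag_mx d ->
  \rank (eigenspace S a) = #|[set i | d 0 i == a]%SET|.
Proof.
move=> PP PD; have [uP uPt] := mulmx1_unit PP.
rewrite /eigenspace mxrank_ker.
have -> : \rank (S - a%:M) = \rank (diag_mx (d - const_mx a)).
  have -> : diag_mx (d - const_mx a) = P *m (S - a%:M) *m P^T.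
    by rewrite linearB/= diag_const_mx mulmxBr mulmxBl PD mul_mx_scalar -scalemxAl PP scalemx1.
  rewrite mxrankMfree ?row_free_unit//.
  by rewrite -[RHS]mxrank_tr trmx_mul mxrankMfree ?row_free_unit// mxrank_tr.
rewrite mxrank_diag.
have -> : [set i | (d - const_mx a) 0 i != 0]%SET = ~: [set i | d 0 i == a]%SET.
  by apply/setP => i; rewrite !inE !mxE subr_eq0.
by rewrite cardsCs finset.setCK card_ord subKn// -[X in (_ <= X)%N]card_ord max_card.
Qed.

End Spectral.

(** * Reduction to a scalar equation *)

Section ScalarEquation.
Context {R : realType} {n : nat}.
Variables B C : R -> R.

(* The factor of [sigma] in the vertical tension at a point [p] of the sphere
   where [p S^2 = (a + b) p S - a b p], with [l = quad S p], [t = |sigma|^2],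
   [tr1] and [tr2] the traces of [S] and [S^2]. *)
Definition radial_eq (a b tr1 tr2 l t : R) : R :=
  let k := a + b - 2 * l in
  let nu := tr2 - 2 * (t + l ^+ 2) - 2 * l * tr1 + (n%:R + 3) * l ^+ 2 in
  - (n%:R + 3) * B t + (2 * k ^+ 2 - nu) * B^`()%classic t
  + k ^+ 2 * t * C^`()%classic t + (nu - (n%:R + 3) * t) * C t.

Section AtPoint.
Variable S : 'M[R]_n.+1.
Hypothesis symS : S^T = S.
Variable x : 'rV[R]_n.
Local Notation phi := (stereo x).

Lemma uvec_mul p (M : 'M[R]_(n.+1, p)) :
  uvec S x *m (frame x *m M) =
  rho x ^+ 2 *: (phi *m S *m M - lam S x *: (phi *m M)).
Proof.
rewrite /uvec mulmxA -[_ *m (frame x)^T *m _]mulmxA tr_frame_mul -scalemxAr -scalemxAl.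
by rewrite mulmxBr mulmx1 mulmxBl [phi *m S *m (_ *m _)]mulmxA lamE mul_scalar_mx -(scalemxAl (lam S x) phi M).
Qed.

Lemma dot_uvec2 :
  dot (uvec S x) (uvec S x) = rho x ^+ 2 * (dot (phi *m S) (phi *m S) - lam S x ^+ 2).
Proof.
have -> : dot (uvec S x) (uvec S x) = (uvec S x *m (frame x *m (S *m phi^T))) 0 0.
  by rewrite /dot -(frame_stereo symS) [frame x *m (_ *m _)]mulmxA.
rewrite uvec_mul [LHS]mxE; congr (_ * _); rewrite [LHS]mxE; congr (_ + _).
  by rewrite /dot trmx_mul symS.
rewrite [LHS]mxE; congr (- _); rewrite [LHS]mxE expr2; congr (_ * _).
by rewrite mulmxA lamE mxE eqxx mulr1n.
Qed.

Lemma sqnorm_quad : sqnorm S x = dot (phi *m S) (phi *m S) - lam S x ^+ 2.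
Proof. by rewrite /sqnorm dot_uvec2 mulrA mulVf ?mul1r// expf_neq0// rho_neq0. Qed.

Lemma mxtrace_frame (M : 'M[R]_n.+1) :
  \tr (frame x *m M *m (frame x)^T) = rho x ^+ 2 * (\tr M - dot (phi *m M) phi).
Proof.
rewrite mxtrace_mulC mulmxA tr_frame_mul -scalemxAl mxtraceZ mulmxBl mul1mx.
rewrite linearB/=; congr (_ * (_ - _)).
by rewrite -mulmxA mxtrace_mulC -/(dot (phi *m M) phi) dotE mxtrace_scalar mulr1n.
Qed.

(** Tangential traces become traces over the ambient space through [tr_frame_mul], so |nabla
    sigma|^2 depends on the point only through |pS|^2 and lambda. *)
Lemma mxtrace_Nmx2 : \tr (Nmx S x *m Nmx S x) = rho x ^+ 4 *
  (\tr (S *m S) - 2 * dot (phi *m S) (phi *m S) - 2 * lam S x * \tr S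
   + (n%:R + 3) * lam S x ^+ 2).
Proof.
pose M := frame x *m S *m (frame x)^T.
have MM : M *m M = rho x ^+ 2 *: (frame x *m (S *m S) *m (frame x)^T
     - (uvec S x)^T *m uvec S x).
  rewrite /M !mulmxA -[_ *m (frame x)^T *m frame x]mulmxA tr_frame_mul.
  rewrite -scalemxAr -!scalemxAl mulmxBr mulmx1 !mulmxBl.
  by rewrite [frame x *m S *m (_ *m _)]mulmxA frame_stereo // /uvec !mulmxA.
have trM : \tr M = rho x ^+ 2 * (\tr S - lam S x) by rewrite /M mxtrace_frame.
have trMM : \tr (M *m M) = rho x ^+ 4 * (\tr (S *m S)
    - 2 * dot (phi *m S) (phi *m S) + lam S x ^+ 2).
  have trU : \tr ((uvec S x)^T *m uvec S x) = dot (uvec S x) (uvec S x).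
    by rewrite mxtrace_mulC dotE mxtrace_scalar mulr1n.
  rewrite MM mxtraceZ linearB/= mxtrace_frame trU dot_uvec2.
  have -> : dot (phi *m (S *m S)) phi = dot (phi *m S) (phi *m S).
    by rewrite /dot trmx_mul symS !mulmxA.
  by ring.
rewrite /Nmx -/M mulmxBr !mulmxBl mul_scalar_mx !mul_mx_scalar scale_scalar_mx.
rewrite !linearB/= !mxtraceZ mxtrace_scalar trMM trM -mulr_natr; ring.
Qed.

Variables a b : R.
Hypothesis quadS : phi *m S *m S = (a + b) *: (phi *m S) - (a * b) *: phi.

(** By [quadS], [S] maps the span of p and pS into itself, and the tangential part of this span is
    the line of sigma; hence sigma is an eigenvector of nabla sigma, with eigenvalue a + b - 2
    lambda. *)
Lemma uvec_Nmx :
  uvec S x *m Nmx S x = (rho x ^+ 2 * (a + b - 2 * lam S x)) *: uvec S x.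
Proof.
rewrite /Nmx mulmxBr -[frame x *m S *m _]mulmxA uvec_mul mul_mx_scalar.
have -> : phi *m S *m (S *m (frame x)^T) = (a + b) *: uvec S x.
  have h0 := mul_stereo_frame x; rewrite mulmxA quadS /uvec.
  move: phi h0 => p h0.
  by rewrite mulmxBl -!scalemxAl h0 scaler0 subr0.
have -> : phi *m (S *m (frame x)^T) = uvec S x by rewrite mulmxA.
by rewrite !scalerBr !scalerA -!scalerBl; congr (_ *: _); ring.
Qed.

Lemma el_vert_radial k : el_vert S B C x k = rho x ^+ 2 * uvec S x 0 k *
  radial_eq a b (\tr S) (\tr (S *m S)) (lam S x) (sqnorm S x).
Proof.
have r0 := rho_neq0 x.
have bE : bvec S x = (a + b - 2 * lam S x) *: uvec S x.
  rewrite /bvec uvec_Nmx scalerA; congr (_ *: _); by field.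
have uuE : dot (uvec S x) (uvec S x) = rho x ^+ 2 * sqnorm S x.
  by rewrite sqnorm_quad dot_uvec2.
have q2 : dot (phi *m S) (phi *m S) = sqnorm S x + lam S x ^+ 2.
  by rewrite sqnorm_quad subrK.
rewrite /el_vert mxtrace_Nmx2 q2 bE -scalemxAl uvec_Nmx !dotZl dotZr uuE.
have ZE c : (c *: uvec S x) 0 k = c * uvec S x 0 k by rewrite mxE.
by rewrite /radial_eq scalerA ZE; field.
Qed.

Lemma uvec_eq0 : (uvec S x == 0) = (sqnorm S x == 0).
Proof.
by rewrite /sqnorm mulf_eq0 dot_eq0 invr_eq0 expf_eq0/= (negPf (rho_neq0 x)).
Qed.

Lemma el_vert_eq0 : (forall k, el_vert S B C x k = 0) <->
  sqnorm S x = 0 \/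
  radial_eq a b (\tr S) (\tr (S *m S)) (lam S x) (sqnorm S x) = 0.
Proof.
have r2 : rho x ^+ 2 != 0 by rewrite expf_neq0// rho_neq0.
split=> [h|[/eqP t0|h] k]; last 2 first.
- move: t0; rewrite -uvec_eq0 => /eqP u0; by rewrite el_vert_radial u0 mxE mulr0 mul0r.
- by rewrite el_vert_radial h mulr0.
have [|t0] := eqVneq (sqnorm S x) 0; [by left|right].
have : uvec S x != 0 by rewrite uvec_eq0.
move/rV0Pn => [k uk]; have /eqP := h k.
by rewrite el_vert_radial mulf_eq0 mulf_eq0 (negPf r2) (negPf uk) /= => /eqP.
Qed.

End AtPoint.

Lemma mxtrace_conj (S Q : 'M[R]_n.+1) : orthogonal_mx Q -> \tr (Q *m S *m Q^T) = \tr S.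
Proof.
by move=> /mulmx1C QQ; rewrite mxtrace_mulC mulmxA QQ mul1mx.
Qed.

(** In the chart of [Q], lambda is the quadratic form of the conjugated matrix read in the standard
    chart. *)
Lemma quad_sectionE (S Q : 'M[R]_n.+1) : S^T = S -> orthogonal_mx Q ->
  quad_section S Q = sect (Q *m S *m Q^T).
Proof.
move=> symS hQ; apply/funext => x; rewrite /quad_section /sect; congr row_mx.
rewrite /quad_field round_metricE// /svec; apply/rowP => i.
have lamQ : (fun y => quad S (chart Q y)) = lam (Q *m S *m Q^T).
  by apply/funext => y; rewrite /quad /chart /lam /dot trmx_mul !mulmxA.
rewrite [LHS]mxE [RHS]mxE [X in _ * X]mxE (bigD1 i)//= big1 => [|j ji]; last first.
  by rewrite invmx_conf mxE eq_sym (negPf ji) mulr0n mul0r.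
rewrite invmx_conf mxE eqxx mulr1n addr0 lamQ /partial.
have symQ : (Q *m S *m Q^T)^T = Q *m S *m Q^T by rewrite !trmx_mul trmxK symS mulmxA.
by case: (isD_lam symQ x i) => _ ->; field; exact: rho_neq0.
Qed.

Lemma harmonic_sectionE (S : 'M[R]_n.+1) : S^T = S -> kaluza_klein n (cst 1) B C ->
  harmonic_section S (cst 1) B C <->
  forall Q, orthogonal_mx Q -> forall x k, el_vert (Q *m S *m Q^T) B C x k = 0.
Proof.
move=> symS [_ [dB _ _] [dC _ _] _ pd].
have E Q x : orthogonal_mx Q -> (let g := round_metric Q in
    vpart g (quad_section S Q x)
      (tension g (kk_metric g (cst 1) B C) (quad_section S Q) x) = 0) <->
    forall k, el_vert (Q *m S *m Q^T) B C x k = 0.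
  move=> hQ; have := pd Q hQ; rewrite /= round_metricE// quad_sectionE// => pdQ.
  apply: vpart_tension_eq0 => //.
  by rewrite !trmx_mul trmxK symS mulmxA.
by split=> h Q hQ x; have := h Q hQ x; rewrite E.
Qed.

Lemma el_vert_chart (S Q : 'M[R]_n.+1) x a b :
  S^T = S -> orthogonal_mx Q ->
  let p := chart Q x in let t := dot (p *m S) (p *m S) - quad S p ^+ 2 in
  p *m S *m S = (a + b) *: (p *m S) - (a * b) *: p ->
  (forall k, el_vert (Q *m S *m Q^T) B C x k = 0) <->
  t = 0 \/ radial_eq a b (\tr S) (\tr (S *m S)) (quad S p) t = 0.
Proof.
move=> symS hQ p t hp; have QQ := mulmx1C hQ.
have symQ : (Q *m S *m Q^T)^T = Q *m S *m Q^T by rewrite !trmx_mul trmxK symS mulmxA.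
have pE M : stereo x *m (Q *m M *m Q^T) = p *m M *m Q^T by rewrite !mulmxA.
have SS : (Q *m S *m Q^T) *m (Q *m S *m Q^T) = Q *m (S *m S) *m Q^T.
  by rewrite !mulmxA -[Q *m S *m Q^T *m Q]mulmxA QQ mulmx1.
have pQ : p *m Q^T = stereo x by rewrite /p /chart -mulmxA hQ mulmx1.
have dotQ (u v : 'rV[R]_n.+1) : dot (u *m Q^T) (v *m Q^T) = dot u v.
  by rewrite /dot trmx_mul trmxK mulmxA -[u *m _ *m _]mulmxA QQ mulmx1.
have lamQ : lam (Q *m S *m Q^T) x = quad S p by rewrite /lam pE -pQ dotQ.
have q : stereo x *m (Q *m S *m Q^T) *m (Q *m S *m Q^T) =
    (a + b) *: (stereo x *m (Q *m S *m Q^T)) - (a * b) *: stereo x.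
  by rewrite -mulmxA SS !pE -pQ mulmxA hp mulmxBl -!scalemxAl.
have tE : sqnorm (Q *m S *m Q^T) x = t by rewrite sqnorm_quad// pE dotQ lamQ.
have := el_vert_eq0 symQ q.
by rewrite SS !mxtrace_conj// lamQ tE.
Qed.

End ScalarEquation.

(** * Necessary conditions *)

Section Forward.
Context {R : realType} {n : nat}.
Hypothesis n_ge2 : (2 <= n)%N.
Variables B C : R -> R.
Hypothesis KK : kaluza_klein n (cst 1) B C.

Lemma stereo0 : @stereo R n 0 = delta_mx 0 0.
Proof.
have r0 : rho (0 : 'rV[R]_n) = 2 by rewrite /rho dot0l addr0 divr1.
rewrite stereoE r0 scaler0 (_ : 2 - 1 = 1 :> R); last by ring.
apply/rowP => i; rewrite !mxE; case: splitP => j ij; rewrite !mxE ?ord1 eqxx /=.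
  by have -> : i = 0 by apply/ord_inj; rewrite ij ord1.
by case: eqP => // i0; move: ij; rewrite i0.
Qed.

(** Positivity is tested on two vertical vectors above a fibre vector [e] with |e|^2 = t: one
    orthogonal to [e], which exists because n >= 2, and one in its direction. *)
Lemma kaluza_klein_gt0 t : 0 <= t -> 0 < B t /\ 0 < B t + t * C t.
Proof.
move=> t0; have [_ _ _ _ pd] := KK.
have o1 : @orthogonal_mx R n 1%:M by rewrite /orthogonal_mx trmx1 mulmx1.
have i0 : (0 < n)%N by apply: leq_trans n_ge2.
pose i : 'I_n := Ordinal i0; pose j : 'I_n := Ordinal n_ge2.
(* The metric at the centre of the chart is 4 times the identity, hence the division by 2. *)
pose e : 'rV[R]_n := (Num.sqrt t / 2) *: delta_mx 0 i.
pose z : 'rV[R]_(n + n) := row_mx 0 e.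
have := pd _ o1 z; rewrite round_metricE// => {}pd.
have form k : 0 < kk_form (@conf_metric R n) (cst 1) B C z (vlift (delta_mx 0 k)) (vlift (delta_mx 0 k)).
  rewrite -kk_metric_ip; apply: pd; apply/eqP => /(congr1 (@rsubmx R 1 n n)).
  rewrite row_mxKr linear0 => /rowP /(_ k); rewrite !mxE !eqxx => /eqP.
  by rewrite oner_eq0.
have zl : lsubmx z = 0 by exact: row_mxKl.
have zr : rsubmx z = e by exact: row_mxKr.
have vl k : lsubmx (vlift (delta_mx 0 k) : 'rV[R]_(n + n)) = 0 by exact: row_mxKl.
have r0 : rho (0 : 'rV[R]_n) = 2 by rewrite /rho dot0l addr0 divr1.
have dd k : dot (delta_mx 0 k : 'rV[R]_n) (delta_mx 0 k) = 1 by rewrite dot_delta mxE !eqxx.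
have st : Num.sqrt t ^+ 2 = t by rewrite sqr_sqrtr.
have tE : 2 ^+ 2 * dot e e = t.
  by rewrite /e dotZl dotZr dd -[RHS]st; field.
have E k := form k; move: E => /= E.
split.
- have := E j; rewrite kk_formE zl zr r0 vl !vpart_vlift dot0l dd tE.
  have -> : dot (delta_mx 0 j) e = 0 by rewrite dot_delta !mxE /= mulr0.
  by rewrite !mulr0 add0r addr0 mulr1 pmulr_lgt0// exprn_gt0.
- have := E i; rewrite kk_formE zl zr r0 vl !vpart_vlift dot0l dd tE.
  have -> : dot (delta_mx 0 i) e = Num.sqrt t / 2 by rewrite dot_delta !mxE !eqxx /= mulr1.
  rewrite (_ : _ + _ = 2 ^+ 2 * (B t + t * C t)); first by rewrite pmulr_rgt0// exprn_gt0.
  have -> : 2 ^+ 2 * (B t + t * C t) = 2 ^+ 2 * (B t + Num.sqrt t ^+ 2 * C t) by rewrite st.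
  by field.
Qed.

Variable S : 'M[R]_n.+1.
Hypothesis symS : S^T = S.
Hypothesis harmS : harmonic_section S (cst 1) B C.

Lemma harmonic_radial (p : 'rV[R]_n.+1) a b : dot p p = 1 ->
  p *m S *m S = (a + b) *: (p *m S) - (a * b) *: p ->
  let t := dot (p *m S) (p *m S) - quad S p ^+ 2 in
  t = 0 \/ radial_eq (n := n) B C a b (\tr S) (\tr (S *m S)) (quad S p) t = 0.
Proof.
move=> pp hp; have [Q [QQ Qp]] := householder pp.
have h := (harmonic_sectionE symS KK).1 harmS Q QQ 0.
have cp : chart Q 0 = p by rewrite /chart stereo0.
have := el_vert_chart (n := n) B C (x := 0) (a := a) (b := b) symS QQ.
by rewrite /= cp => /(_ hp) /iffLR; apply.
Qed.

Lemma radial_pair (p q : 'rV[R]_n.+1) a b l :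
  dot p p = 1 -> dot q q = 1 -> dot p q = 0 ->
  p *m S = a *: p -> q *m S = b *: q -> l ^+ 2 < (a - b) ^+ 2 / 4 ->
  radial_eq (n := n) B C a b (\tr S) (\tr (S *m S)) ((a + b) / 2 + l)
    ((a - b) ^+ 2 / 4 - l ^+ 2) = 0.
Proof.
move=> pp qq pq pS qS hl; set T := _ / 4.
have ab0 : a - b != 0.
  by apply: contraTneq hl => ->; rewrite expr0n mul0r -leNgt sqr_ge0.
(* For v = c p + s q with c^2 = 1/2 + u and s^2 = 1/2 - u, lambda(v) = (a+b)/2 + (a-b) u, so this
   [u] realises the prescribed [l]. *)
pose u := l / (a - b).
have uu : u ^+ 2 < 1 / 4.
  by rewrite /u expr_div_n ltr_pdivrMr ?exprn_even_gt0// mul1r mulrC.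
have /andP[u1 u2] : - (1 / 2) < u < 1 / 2.
  rewrite -ltr_norml -(@ltr_pXn2r _ 2)// ?nnegrE ?divr_ge0//.
  by rewrite real_normK ?num_real//; apply: lt_le_trans uu _; lra.
have c0 : 0 <= 1 / 2 + u by lra.
have s0 : 0 <= 1 / 2 - u by lra.
pose c := Num.sqrt (1 / 2 + u); pose s := Num.sqrt (1 / 2 - u).
have cc : c ^+ 2 = 1 / 2 + u by rewrite sqr_sqrtr.
have ss : s ^+ 2 = 1 / 2 - u by rewrite sqr_sqrtr.
pose v := c *: p + s *: q.
have vS : v *m S = (a * c) *: p + (b * s) *: q.
  by rewrite mulmxDl -!scalemxAl pS qS !scalerA mulrC [s * b]mulrC.
have dotv (x y x' y' : R) : dot (x *: p + y *: q) (x' *: p + y' *: q) = x * x' + y * y'.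
  by rewrite !(dotDl, dotDr, dotZl, dotZr) pp qq pq [dot q p]dotC pq; ring.
have vv : dot v v = 1 by rewrite dotv -!expr2 cc ss; field.
have lE : quad S v = (a + b) / 2 + l.
  rewrite /quad vS dotv -!mulrA -!expr2 cc ss /u; by field.
have tE : dot (v *m S) (v *m S) - quad S v ^+ 2 = T - l ^+ 2.
  rewrite lE vS dotv -!mulrA [c * _]mulrCA [s * _]mulrCA -!expr2 cc ss /T /u; by field.
have hv : v *m S *m S = (a + b) *: (v *m S) - (a * b) *: v.
  rewrite vS mulmxDl -!scalemxAl pS qS /v; apply/rowP => i; rewrite !mxE; ring.
(* The strict bound on [l] excludes the alternative t = 0, where sigma vanishes and harmonicity says
   nothing. *)
have := harmonic_radial vv hv; rewrite /= tE lE => -[|//] /eqP.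
by rewrite subr_eq0 => /eqP E; move: hl; rewrite -/T E ltxx.
Qed.

Lemma trace_pair (p q : 'rV[R]_n.+1) a b :
  dot p p = 1 -> dot q q = 1 -> dot p q = 0 ->
  p *m S = a *: p -> q *m S = b *: q -> a != b ->
  \tr S = (n%:R + 1) * ((a + b) / 2).
Proof.
move=> pp qq pq pS qS ab; have h := @radial_pair p q a b _ pp qq pq pS qS.
have [_ [_ ddB _] [dC _ _] _ _] := KK.
set T := (a - b) ^+ 2 / 4 in h.
have T0 : 0 < T by rewrite divr_gt0// exprn_even_gt0//= subr_eq0.
pose f t := C t - B^`()%classic t.
have fT : f T != 0.
  have := h 0; rewrite expr0n /= subr0 addr0 => /(_ T0); rewrite /radial_eq /f.
  have [_] := kaluza_klein_gt0 (ltW T0).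
  move: (B T) (B^`()%classic T) (C T) (C^`()%classic T) => B0 B1 C0 C1 W.
  move=> E; apply/eqP => /eqP; rewrite subr_eq0 => /eqP CB.
  have : (n%:R + 3) * (B0 + T * C0) = 0.
    by rewrite -[RHS]oppr0 -[in RHS]E -CB; field.
  by move/eqP; rewrite mulf_eq0 (gt_eqF W) orbF gt_eqF// ltr_wpDl.
have cf : {for T, continuous f}.
  by apply: continuousB; [exact: continuous_derivable | exact: continuous_derivable].
have /nbhs_ballP[d /= d0 hd] : \forall t \near T, f t != 0 by exact: cvgr_neq0 cf fT.
(* The bound m <= 1 gives m^2 <= m, so T - m^2 is positive and stays in the ball where [f] does not
   vanish. *)
pose m := Num.min 1 (Num.min d T / 2).
have m0 : 0 < m by rewrite /m lt_min ltr01 divr_gt0// lt_min d0.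
have m2 : m ^+ 2 < Num.min d T.
  apply: (@le_lt_trans _ _ (Num.min d T / 2)).
    apply: (@le_trans _ _ m); last by rewrite ge_min lexx orbT.
    by rewrite expr2 ler_piMl ?(ltW m0)// ge_min lexx.
  by rewrite ltr_pdivrMr// ltr_pMr ?ltr1n// lt_min d0.
have /andP[md mT] : (m ^+ 2 < d) && (m ^+ 2 < T) by rewrite -lt_min.
have fm : f (T - m ^+ 2) != 0.
  by apply: hd; rewrite /ball/= opprB addrC subrK ger0_norm ?sqr_ge0.
have h1 := h m mT; have h2 := h (- m); rewrite sqrrN in h2; have {}h2 := h2 mT.
move: h1 h2 fm; rewrite /radial_eq /f.
set t := T - m ^+ 2.
move: (B t) (B^`()%classic t) (C t) (C^`()%classic t) => B0 B1 C0 C1 h1 h2 fm.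
have : 4 * m * ((n%:R + 1) * ((a + b) / 2) - \tr S) * (C0 - B1) = 0.
  by rewrite -[RHS](subrr 0) -[in X in _ = X - _]h1 -[in X in _ = _ - X]h2; field.
move/eqP; rewrite mulf_eq0 (negPf fm) orbF mulf_eq0 mulf_eq0 (gt_eqF m0) orbF.
by rewrite pnatr_eq0 /= subr_eq0 => /eqP ->.
Qed.

End Forward.

(** * Eigenvalues and multiplicities read off a diagonalization *)

Section TwoEigenvalues.
Context {R : realType} {n : nat}.
Variables (S P : 'M[R]_n.+1) (d : 'rV[R]_n.+1).
Hypotheses (PP : P *m P^T = 1%:M) (PD : P *m S *m P^T = diag_mx d).

Let Pt : P^T *m P = 1%:M. Proof. exact: mulmx1C. Qed.

Lemma diagE : S = P^T *m diag_mx d *m P.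
Proof. by rewrite -PD !mulmxA Pt mul1mx -mulmxA Pt mulmx1. Qed.

Definition evec i : 'rV[R]_n.+1 := delta_mx 0 i *m P.

Lemma evec_mul i : evec i *m S = d 0 i *: evec i.
Proof.
rewrite diagE /evec !mulmxA -[delta_mx 0 i *m P *m P^T]mulmxA PP mulmx1.
rewrite -rowE; have -> : row i (diag_mx d) = d 0 i *: delta_mx 0 i.
  apply/rowP => j; rewrite !mxE eqxx /= (eq_sym j i).
  by case: (eqVneq i j) => [->|_]; rewrite ?mulr1n ?mulr0n ?mulr1 ?mulr0.
by rewrite scalemxAl.
Qed.

Lemma dot_evec i j : dot (evec i) (evec j) = (i == j)%:R.
Proof. by rewrite /evec dot_rows PP mxE. Qed.

Lemma mxtrace_diag : \tr S = \sum_i d 0 i.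
Proof. by rewrite diagE mxtrace_mulC mulmxA PP mul1mx mxtrace_diag. Qed.

Lemma eigenvalue_diag a : eigenvalue S a = [exists i, d 0 i == a].
Proof.
rewrite /eigenvalue -mxrank_eq0 (rank_eigenspace a PP PD) -lt0n card_gt0.
apply/set0Pn/existsP => -[i hi]; exists i; move: hi; by rewrite inE.
Qed.

Lemma quadratic_diag a b : (forall i, d 0 i = a \/ d 0 i = b) ->
  S *m S = (a + b) *: S - (a * b)%:M.
Proof.
move=> h.
have DD : diag_mx d *m diag_mx d = (a + b) *: diag_mx d - (a * b)%:M.
  rewrite mul_diag_mx; apply/matrixP => i j; rewrite !mxE.
  by case: (h i) => ->; case: (i == j) => /=; ring.
rewrite diagE !mulmxA -[_ *m P *m P^T]mulmxA PP mulmx1 -[P^T *m _ *m _]mulmxA DD.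
rewrite mulmxBr mulmxBl -scalemxAr -scalemxAl mul_mx_scalar -scalemxAl Pt.
by rewrite scalemx1.
Qed.

Local Notation mult a := #|[set i | d 0 i == a]%SET|.

Lemma mult_add a b : a != b -> (forall i, d 0 i = a \/ d 0 i = b) ->
  (mult a + mult b)%N = n.+1.
Proof.
move=> ab h; rewrite -[RHS]card_ord -(cardsC [set i | d 0 i == a]%SET).
congr (_ + _)%N.
apply: eq_card => i; rewrite !inE.
by case: (h i) => ->; rewrite eqxx ?(negPf ab)// eq_sym (negPf ab).
Qed.

Lemma mxtrace_mult a b : a != b -> (forall i, d 0 i = a \/ d 0 i = b) ->
  \tr S = (mult a)%:R * a + (mult b)%:R * b.
Proof.
move=> ab h; rewrite mxtrace_diag (bigID (fun i => d 0 i == a))/=.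
congr (_ + _).
  rewrite (eq_bigr (fun=> a)) => [|i /eqP//].
  by rewrite -big_set/= sumr_const mulr_natl.
have E i : (d 0 i != a) = (d 0 i == b).
  by case: (h i) => ->; rewrite eqxx ?(negPf ab)// eq_sym (negPf ab).
rewrite (eq_bigl _ _ E) (eq_bigr (fun=> b)) => [|i /eqP//].
by rewrite -big_set/= sumr_const mulr_natl.
Qed.

Lemma two_eigenvaluesP a b : (0 < n)%N -> two_eigenvalues S a b <->
  [/\ b < a, forall i, d 0 i = a \/ d 0 i = b, mult a = n.+1./2 & mult b = n.+1./2].
Proof.
move=> n0; rewrite /two_eigenvalues !(rank_eigenspace _ PP PD).
split=> -[ba h ma mb]; split=> //.
  move=> i; have : eigenvalue S (d 0 i) by rewrite eigenvalue_diag; apply/existsP; exists i.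
  by rewrite h => /orP[]/eqP ->; [left|right].
have ex c : mult c = n.+1./2 -> exists i, d 0 i = c.
  move=> mc; have : (0 < mult c)%N by rewrite mc half_gt0.
  by rewrite card_gt0 => /set0Pn[i]; rewrite inE => /eqP; exists i.
move=> c; rewrite eigenvalue_diag; apply/existsP/orP => [[i /eqP <-]|].
  by case: (h i) => ->; [left|right].
by case=> /eqP ->; [have [i <-] := ex _ ma | have [i <-] := ex _ mb]; exists i.
Qed.

End TwoEigenvalues.

Section Structure.
Context {R : realType} {n : nat}.
Variable S : 'M[R]_n.+1.
Hypothesis symS : S^T = S.

Lemma two_eigenvalues_quadratic a b : odd n -> two_eigenvalues S a b ->
  [/\ S *m S = (a + b) *: S - (a * b)%:M,
      \tr S = (n%:R + 1) * ((a + b) / 2),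
      \tr (S *m S) = (n%:R + 1) * ((a ^+ 2 + b ^+ 2) / 2) &
      exists p q : 'rV[R]_n.+1, [/\ dot p p = 1, dot q q = 1, dot p q = 0,
        p *m S = a *: p & q *m S = b *: q]].
Proof.
move=> on; have [P [d [PP PD]]] := symmetric_diagonalization symS.
have n0 : (0 < n)%N by case: (n) on.
move/(two_eigenvaluesP PP PD a b n0) => [ba h ma mb].
have ab : a != b by rewrite gt_eqF.
have SS := quadratic_diag PP PD h.
(* Oddness of [n] makes [n.+1./2] an exact half. *)
have nE : n%:R + 1 = 2 * (n.+1./2)%:R :> R.
  by rewrite natr1 -natrM mul2n; congr (_%:R); rewrite -[LHS]odd_double_half /= on add0n.
have trS : \tr S = (n%:R + 1) * ((a + b) / 2).
  by rewrite (mxtrace_mult PP PD ab h) ma mb nE; field.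
split=> //.
  rewrite SS linearB/= mxtraceZ mxtrace_scalar trS -mulr_natr -natr1; by field.
have ex c : #|[set i | d 0 i == c]%SET| = n.+1./2 -> exists i, d 0 i = c.
  move=> mc; have : (0 < n.+1./2)%N by rewrite half_gt0.
  by rewrite -mc card_gt0 => /set0Pn[i]; rewrite inE => /eqP; exists i.
have [i di] := ex _ ma; have [j dj] := ex _ mb.
exists (evec P i), (evec P j); rewrite !(dot_evec PP) !eqxx !(evec_mul PP PD) di dj.
by split=> //; case: eqP => // ij; move: ab; rewrite -di -dj ij eqxx.
Qed.

Lemma trace_two_eigenvalues :
  (exists p q : 'rV[R]_n.+1, [/\ dot p p = 1, dot q q = 1 & quad S p <> quad S q]) ->
  (0 < n)%N ->
  (forall (p q : 'rV[R]_n.+1) a b, dot p p = 1 -> dot q q = 1 -> dot p q = 0 ->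
    p *m S = a *: p -> q *m S = b *: q -> a != b ->
    \tr S = (n%:R + 1) * ((a + b) / 2)) ->
  odd n /\ exists a b, two_eigenvalues S a b.
Proof.
move=> [p [q [pp qq pq]]] n0 tr.
have [P [d [PP PD]]] := symmetric_diagonalization symS.
have trd i j : d 0 i != d 0 j -> \tr S = (n%:R + 1) * ((d 0 i + d 0 j) / 2).
  move=> dij; apply: (tr (evec P i) (evec P j)); rewrite ?(dot_evec PP) ?eqxx//.
  - by case: eqP => // ij; move: dij; rewrite ij eqxx.
  - exact: evec_mul.
  - exact: evec_mul.
(* If all eigenvalues coincided, [S] would be scalar and lambda constant on the sphere. *)
have [i [j dij]] : exists i j, d 0 j < d 0 i.
  apply/not_existsP => hd; apply: pq.
  have dE i : d 0 i = d 0 0.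
    have le k l : d 0 k <= d 0 l by rewrite leNgt; apply/negP => lt; apply: (hd k); exists l.
    by apply/eqP; rewrite eq_le !le.
  have -> : S = (d 0 0)%:M.
    rewrite (diagE PP PD) [d](_ : _ = const_mx (d 0 0)).
      by rewrite diag_const_mx mul_mx_scalar -scalemxAl (mulmx1C PP) mxE scalemx1.
    by apply/rowP => i; rewrite mxE.
  by rewrite /quad !mul_mx_scalar !dotZl pp qq.
have n1 : n%:R + 1 != 0 :> R by rewrite natr1 pnatr_eq0.
(* The trace fixes the sum of any two distinct eigenvalues, so whatever differs from [d 0 i] equals
   [d 0 j]. *)
have h k : d 0 k = d 0 i \/ d 0 k = d 0 j.
  have [ki|ki] := eqVneq (d 0 k) (d 0 i); [by left|right].
  have := trd k i ki; rewrite (trd i j) ?gt_eqF// => /(mulfI n1) E.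
  by move: E; lra.
have ab : d 0 i != d 0 j by rewrite gt_eqF.
have := mult_add ab h; have := mxtrace_mult PP PD ab h.
set ma := #|_|; set mb := #|_| => trE mE.
(* Equating ma a + mb b with (ma + mb)(a + b)/2 leaves (ma - mb)(a - b) = 0. *)
have mab : ma = mb.
  have nE : n%:R + 1 = ma%:R + mb%:R :> R by rewrite natr1 -mE natrD.
  have : (ma%:R - mb%:R) * (d 0 i - d 0 j) = 0 :> R.
    have := trd i j ab; rewrite trE nE => E.
    by apply: (@mulIf _ 2^-1); rewrite ?invr_eq0// mul0r -[RHS](subrr (ma%:R * d 0 i + mb%:R * d 0 j)) {2}E; field.
  by move/eqP; rewrite mulf_eq0 !subr_eq0 (negPf ab) orbF eqr_nat => /eqP.
have nh : n.+1 = ma.*2 by rewrite -mE -mab addnn.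
split; first by rewrite -[odd n]negbK -[~~ odd n]/(odd n.+1) nh odd_double.
exists (d 0 i), (d 0 j); apply/(two_eigenvaluesP PP PD _ _ n0).
have hf : n.+1./2 = ma by apply: (etrans (congr1 half nh)); rewrite doubleK.
by split=> //; rewrite hf// -/mb -mab.
Qed.

End Structure.

(** * The differential equation in t, and its insolubility for n = 3 *)

Section RadialODE.
Context {R : realType}.
Variables (n : nat) (B C : R -> R) (a b : R).
Let T := (a - b) ^+ 2 / 4.

(** With these traces the terms odd in [l] cancel, and [l] survives only through l^2 = T - t. *)
Lemma radial_eq_two l : let t := T - l ^+ 2 in
  radial_eq (n := n) B C a b ((n%:R + 1) * ((a + b) / 2))
    ((n%:R + 1) * ((a ^+ 2 + b ^+ 2) / 2)) ((a + b) / 2 + l) t =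
  - (n%:R + 3) * B t - (2 * (n%:R - 3) * T - (n%:R - 5) * t) * B^`()%classic t
  + 4 * (T - t) * t * C^`()%classic t
  + (2 * (n%:R + 1) * T - 2 * (n%:R + 3) * t) * C t.
Proof.
move=> t; rewrite /radial_eq -/t.
move: (B t) (B^`()%classic t) (C t) (C^`()%classic t) => B0 B1 C0 C1.
rewrite /t /T; by field.
Qed.

End RadialODE.

Section DimensionThree.
Context {R : realType}.
Variables (B C : R -> R) (a b : R).
Hypotheses (dB : forall t, derivable B t 1) (dC : forall t, derivable C t 1).
Hypothesis B_gt0 : forall t, 0 <= t -> 0 < B t.
Hypothesis ab : a != b.
Let T := (a - b) ^+ 2 / 4.

Lemma radial_eq_dim3 : ~ forall l, l ^+ 2 < T ->
  radial_eq (n := 3) B C a b ((3%:R + 1) * ((a + b) / 2))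
    ((3%:R + 1) * ((a ^+ 2 + b ^+ 2) / 2)) ((a + b) / 2 + l) (T - l ^+ 2) = 0.
Proof.
move=> h.
have T0 : 0 < T by rewrite divr_gt0// exprn_even_gt0//= subr_eq0.
(* The integrating factor is t/2: for n = 3, t/2 times the left-hand side of the equation is H'(t) -
   t B(t). *)
pose H : R -> R := fun t => 2 * (t * t) * (T - t) * C t - t * t * B t.
have dH (t : R) : is_derive t (1 : R) H
    (t / 2 * (- 6 * B t - 2 * t * B^`()%classic t + 4 * (T - t) * t * C^`()%classic t
      + (8 * T - 12 * t) * C t) + t * B t).
  have ht : is_derive t (1 : R) (fun s : R => s) 1 by exact: is_derive_id.
  have htt := isD_mul ht ht.
  have hB : is_derive t (1 : R) B (B^`()%classic t).
    by rewrite derive1E; apply: derivableP; exact: dB.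
  have hC : is_derive t (1 : R) C (C^`()%classic t).
    by rewrite derive1E; apply: derivableP; exact: dC.
  have h1 := isD_mul (isD_mul (isD_mul (isD_cst t (1 : R) 2) htt)
    (isD_add (isD_cst t (1 : R) T) (isD_opp ht))) hC.
  have hh : is_derive t (1 : R) H _ := isD_add h1 (isD_opp (isD_mul htt hB)).
  apply: (is_derive_eq hh); by field.
have cH : {within `[0, T], continuous H}.
  apply: continuous_subspaceT => t; apply: continuous_derivable; by case: (dH t).
(* The mean value point lies in ]0, T[, where the equation holds with l^2 = T - c; thus -T^2 B(T) =
   c B(c) T, with sides of opposite signs. *)
have [c] := MVT T0 (fun t _ => dH t) cH.
rewrite in_itv/= => /andP[c0 cT].
pose l := Num.sqrt (T - c).
have ll : l ^+ 2 = T - c by rewrite sqr_sqrtr// subr_ge0 ltW.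
have lT : l ^+ 2 < T by rewrite ll; lra.
have cE : T - (T - c) = c by ring.
have := h l lT; have := radial_eq_two 3 B C a b l; rewrite /= -/T ll cE => -> E.
rewrite [X in X * (T - 0)](_ : _ = c * B c); last first.
  rewrite -[RHS]add0r -[in RHS](mulr0 (c / 2)) -[in RHS]E; congr (_ + _).
  by congr (_ * _); ring.
rewrite /H mul0r !mulr0 !mul0r subrr mulr0 mul0r subr0 sub0r subr0 => E2.
have BT := B_gt0 (ltW T0); have Bc := B_gt0 (ltW c0).
have p1 := mulr_gt0 (mulr_gt0 c0 Bc) T0.
have p2 := mulr_gt0 (mulr_gt0 T0 T0) BT.
by move: E2 p1 p2; rewrite subr0; lra.
Qed.

End DimensionThree.

(** * Sufficient conditions *)

Section Existence.
Context {R : realType}.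

Lemma is_derive1E (f : R -> R) t d : is_derive t (1 : R) f d -> f^`()%classic t = d.
Proof. by move=> [_ <-]; rewrite derive1E. Qed.

Lemma C2_intro (f f1 f2 : R -> R) :
  (forall t, is_derive t (1 : R) f (f1 t)) ->
  (forall t, is_derive t (1 : R) f1 (f2 t)) -> continuous f2 -> C2 f.
Proof.
move=> h1 h2 c2.
have E1 : f^`()%classic = f1 by apply/funext => t; exact: is_derive1E.
have E2 : f^`(2)%classic = f2.
  rewrite derive1nS derive1n1 E1; apply/funext => t; exact: is_derive1E.
by split=> [t|t|]; rewrite ?E1 ?E2.
Qed.

Lemma C2_cst (c : R) : C2 (cst c).
Proof.
apply: (C2_intro (f1 := fun=> 0) (f2 := fun=> 0)
  (fun t => isD_cst t (1 : R) c) (fun t => isD_cst t (1 : R) 0)).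
exact: cst_continuous.
Qed.

Lemma kaluza_klein_C0 n (B : R -> R) :
  C2 B -> (forall t, 0 <= t -> 0 < B t) -> kaluza_klein n (cst 1) B (cst 0).
Proof.
move=> cB B0; split; [exact: C2_cst | exact: cB | exact: C2_cst | |].
  by move=> t _; exact: ltr01.
move=> Q hQ z w w0; rewrite round_metricE// kk_metric_ip kk_formE /= mul0r mul0r addr0.
set r := rho _; set t := _ * dot (rsubmx z) _; set v := vpart _ _ _.
have r2 : 0 < r ^+ 2 by rewrite exprn_gt0// rho_gt0.
have Bt : 0 < B t by apply: B0; rewrite mulr_ge0 ?dot_ge0// ltW.
have h1 : 0 <= r ^+ 2 * dot (lsubmx w) (lsubmx w) by rewrite mulr_ge0 ?dot_ge0// ltW.
have h2 : 0 <= B t * (r ^+ 2 * dot v v) by apply: mulr_ge0; [exact: ltW | apply: mulr_ge0; [exact: ltW | exact: dot_ge0]].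
rewrite lt0r (addr_ge0 h1 h2) andbT (paddr_eq0 h1 h2).
rewrite mulf_eq0 (gt_eqF r2) mulf_eq0 (gt_eqF Bt) mulf_eq0 (gt_eqF r2) /= !dot_eq0.
apply: contra w0 => /andP[/eqP l0 /eqP v0]; apply/eqP.
move: v0; rewrite /v /vpart l0 christoffel_appE big1 => [|i _]; last by rewrite mxE scale0r.
by rewrite addr0 => w2; rewrite -[w]hsubmxK l0 w2 row_mx0.
Qed.

(** Two eigenvalues give S^2 = (a+b) S - ab, so every point of the sphere satisfies the relation
    behind the scalar equation. There t = T - l^2 <= T, and sigma vanishes where t = 0, so the
    equation matters only on ]0, T]. *)
Lemma harmonic_section_two n (S : 'M[R]_n.+1) a b (B : R -> R) :
  S^T = S -> odd n -> two_eigenvalues S a b ->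
  C2 B -> (forall t, 0 <= t -> 0 < B t) ->
  (forall t, 0 < t <= (a - b) ^+ 2 / 4 ->
    (n%:R + 3) * B t
    + (2 * (n%:R - 3) * ((a - b) ^+ 2 / 4) - (n%:R - 5) * t) * B^`()%classic t = 0) ->
  harmonic_section S (cst 1) B (cst 0).
Proof.
move=> symS on hab cB B0 ode.
have [SS tr1 tr2 _] := two_eigenvalues_quadratic symS on hab.
apply/(harmonic_sectionE symS (kaluza_klein_C0 n cB B0)) => Q hQ x.
pose p := chart Q x.
have QQ := mulmx1C hQ.
have pp : dot p p = 1.
  by rewrite /p /chart /dot trmx_mul mulmxA -[_ *m Q *m _]mulmxA hQ mulmx1; exact: dot_stereo.
have hp : p *m S *m S = (a + b) *: (p *m S) - (a * b) *: p.
  by rewrite -mulmxA SS mulmxBr -scalemxAr mul_mx_scalar.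
apply/(el_vert_chart B (cst 0) symS hQ hp).
set t := _ - _; pose l := quad S p - (a + b) / 2.
have pSS : dot (p *m S) (p *m S) = (a + b) * quad S p - a * b.
  have -> : dot (p *m S) (p *m S) = dot (p *m S *m S) p.
    by rewrite /dot trmx_mul symS !mulmxA.
  by rewrite hp dotDl dotNl !dotZl pp mulr1.
have tE : t = (a - b) ^+ 2 / 4 - l ^+ 2 by rewrite /t pSS /l; field.
have t0 : 0 <= t.
  suff -> : t = dot (p *m S - quad S p *: p) (p *m S - quad S p *: p) by exact: dot_ge0.
  rewrite dotDl !dotDr !dotNl ![dot _ (- _)]dotC !dotNl !dotZl !dotZr pp.
  by rewrite [dot p _]dotC -/(quad S p) /t; ring.
have [->|tn0] := eqVneq t 0; [by left|right].
rewrite tr1 tr2 (_ : quad S p = (a + b) / 2 + l); last by rewrite /l; ring.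
rewrite tE radial_eq_two -tE derive1_cst /= !mulr0 !addr0.
have := ode t; rewrite lt_neqAle eq_sym tn0 t0 /= => /(_ _) h.
have {}h := h _; rewrite -[RHS]oppr0 -h; first by ring.
by rewrite tE lerBlDr lerDl sqr_ge0.
Qed.

(** Meant for the squared positive part, whose first-order remainder is at most h^2 even across the
    kink at 0. *)
Lemma is_derive_quadratic_bound (f : R -> R) x d :
  (forall h, `|f (x + h) - f x - d * h| <= h ^+ 2) -> is_derive x (1 : R) f d.
Proof.
move=> fq.
have cv : h^-1 *: ((f \o shift x) (h *: (1 : R)) - f x) @[h --> 0^'] --> d.
  apply/cvgrPdist_le => e e0; near=> h.
  have h0 : h != 0 by near: h; exact: nbhs_dnbhs_neq.
  have -> : d - h^-1 *: ((f \o shift x) (h *: (1 : R)) - f x) =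
      - (h^-1 * (f (x + h) - f x - d * h)).
    rewrite /= [_%:A]mulr1 addrC [h + x]addrC -[_ *: _]/(_ * _); by field.
  rewrite normrN normrM normfV ler_pdivrMl ?normr_gt0//.
  apply: le_trans (fq h) _; rewrite -real_normK ?num_real// expr2.
  rewrite ler_wpM2l//.
  by near: h; exact: dnbhs0_le.
apply: DeriveDef; first by apply/cvg_ex; exists d.
exact: cvg_lim cv.
Unshelve. all: by end_near. Qed.

Lemma isD_posp2 (s : R) :
  is_derive s (1 : R) (fun s => Num.max s 0 ^+ 2) (2 * Num.max s 0).
Proof.
apply: is_derive_quadratic_bound => h; rewrite ler_norml; apply/andP.
by case: (leP s 0) => s0; case: (leP (s + h) 0) => h0; split; nra.
Qed.

(** The cube is the lowest integer power of the positive part that is C^2, whence its use in the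
    prolongation. *)
Lemma isD_posp3 (s : R) :
  is_derive s (1 : R) (fun s => Num.max s 0 ^+ 3) (3 * Num.max s 0 ^+ 2).
Proof.
have -> : (fun s : R => Num.max s 0 ^+ 3) = (fun s => s * Num.max s 0 ^+ 2).
  by apply/funext => u; case: (leP u 0) => _; ring.
have hs : is_derive s (1 : R) (fun s : R => s) 1 by exact: is_derive_id.
apply: (is_derive_eq (isD_mul hs (isD_posp2 s))).
by case: (leP s 0) => _; ring.
Qed.

Lemma C2_expRln (K gam : R) (psi psi1 psi2 : R -> R) :
  (forall t, 0 < psi t) -> (forall t, is_derive t (1 : R) psi (psi1 t)) ->
  (forall t, is_derive t (1 : R) psi1 (psi2 t)) -> continuous psi2 ->
  C2 (fun t => K * expR (gam * ln (psi t))).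
Proof.
move=> p0 h1 h2 c2; set B := fun t => _.
have p0' t : psi t != 0 by rewrite gt_eqF.
have hB t : is_derive t (1 : R) B (B t * (gam * (psi1 t / psi t))).
  have hl := isD_comp_at (is_derive1_ln (p0 t)) (h1 t).
  have he := isD_comp_at (is_derive_expR _) (isD_mul (isD_cst t (1 : R) gam) hl).
  apply: (is_derive_eq (isD_mul (isD_cst t (1 : R) K) he)); rewrite /B; ring.
have hh t : is_derive t (1 : R) (fun t => gam * (psi1 t / psi t))
    (gam * (psi2 t / psi t - (psi1 t / psi t) ^+ 2)).
  have hv := isD_inv (p0' t) (h1 t).
  apply: (is_derive_eq (isD_mul (isD_cst t (1 : R) gam) (isD_mul (h2 t) hv))).
  by field.
apply: (C2_intro hB (fun t => isD_mul (hB t) (hh t))).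
have cB : continuous B by move=> t; apply: continuous_derivable; case: (hB t).
have cp : continuous psi by move=> t; apply: continuous_derivable; case: (h1 t).
have cp1 : continuous psi1 by move=> t; apply: continuous_derivable; case: (h2 t).
have cV : continuous (fun t => (psi t)^-1) by move=> t; apply: continuousV => //; exact: cp.
have cM (f g : R -> R) : continuous f -> continuous g -> continuous (fun t => f t * g t).
  by move=> cf cg t; exact: continuousM (cf t) (cg t).
have cg : continuous (fun _ : R => gam) by exact: cst_continuous.
have cr := cM _ _ cp1 cV; have cgr := cM _ _ cg cr.
have cq : continuous (fun t => psi2 t / psi t - (psi1 t / psi t) ^+ 2).
  by move=> t; exact: continuousB (cM _ _ c2 cV t) (cM _ _ cr cr t).
by move=> t; exact: continuousD (cM _ _ (cM _ _ cB cgr) cgr t) (cM _ _ cB (cM _ _ cg cq) t).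
Qed.

(* Beyond [T] the positive affine function [al - be t] is continued by adding
   a multiple of [(t - T)^3]. *)
Lemma prolongation_exists (K gam al be T : R) :
  0 < K -> 0 < be -> be * T < al ->
  exists B, prolongation T (fun t => K * (al - be * t) `^ gam) B.
Proof.
move=> K0 be0 alT; pose y := al - be * T.
have y0 : 0 < y by rewrite subr_gt0.
(* With s = t - T > 0, the continued function is y - be s + k s^3. It is positive while be s < y;
   beyond that, k s^3 = 4 be s (be s/y)^2 >= 4 be s outweighs the linear loss. *)
pose k := 4 * be ^+ 3 / y ^+ 2.
pose psi t := al - be * t + k * Num.max (t - T) 0 ^+ 3.
have k0 : 0 < k by rewrite !(mulr_gt0, invr_gt0, exprn_gt0).
have psi_gt0 t : 0 < psi t.
  rewrite /psi; case: (leP (t - T) 0) => s0.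
    rewrite expr0n mulr0 addr0; apply: lt_le_trans y0 _.
    by rewrite lerD2l lerN2 ler_pM2l// -subr_le0.
  set s := t - T in s0 *.
  have -> : al - be * t = y - be * s by rewrite /y /s; ring.
  have [sy|sy] := ltP (be * s) y.
    by rewrite ltr_wpDr ?subr_gt0// ltW// mulr_gt0// exprn_gt0.
  have ks : 4 * (be * s) <= k * s ^+ 3.
    have -> : k * s ^+ 3 = 4 * (be * s) * ((be * s) / y) ^+ 2.
      by rewrite /k; field; rewrite gt_eqF.
    rewrite ler_peMr ?mulr_ge0 ?(ltW be0) ?(ltW s0)//.
    by rewrite exprn_ege1// ler_pdivlMr// mul1r.
  have bs : 0 < be * s by rewrite mulr_gt0.
  lra.
have hs (t : R) : is_derive t (1 : R) (fun t : R => t) 1 by exact: is_derive_id.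
have hsT (t : R) : is_derive t (1 : R) (fun t => t - T) 1.
  by apply: (is_derive_eq (isD_add (hs t) (isD_cst t (1 : R) (- T)))); rewrite addr0.
have h1 (t : R) : is_derive t (1 : R) psi (- be + 3 * k * Num.max (t - T) 0 ^+ 2).
  have hl := isD_add (isD_cst t (1 : R) al) (isD_opp (isD_mul (isD_cst t (1 : R) be) (hs t))).
  have hc := isD_mul (isD_cst t (1 : R) k) (isD_comp_at (f := fun u => u - T) (isD_posp3 (t - T)) (hsT t)).
  by apply: (is_derive_eq (isD_add hl hc)); ring.
have h2 (t : R) : is_derive t (1 : R) (fun t => - be + 3 * k * Num.max (t - T) 0 ^+ 2)
    (6 * k * Num.max (t - T) 0).
  have hc := isD_mul (isD_cst t (1 : R) (3 * k)) (isD_comp_at (f := fun u => u - T) (isD_posp2 (t - T)) (hsT t)).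
  by apply: (is_derive_eq (isD_add (isD_cst t (1 : R) (- be)) hc)); ring.
have c2 : continuous (fun t => 6 * k * Num.max (t - T) 0).
  move=> t; have ct : {for t, continuous (fun u : R => u - T)}.
    by apply: continuous_derivable; case: (hsT t).
  have c0 : {for t, continuous (fun _ : R => 0 : R)} by exact: cst_continuous.
  have ck : {for t, continuous (fun _ : R => 6 * k)} by exact: cst_continuous.
  exact: continuousM ck (continuous_max ct c0).
exists (fun t => K * expR (gam * ln (psi t))); split.
- exact: C2_expRln psi_gt0 h1 h2 c2.
- move=> t /andP[t0 tT]; congr (_ * _).
  have -> : psi t = al - be * t.
    by rewrite /psi max_r ?subr_le0// expr0n mulr0 addr0.
  rewrite /powR gt_eqF// subr_gt0 (le_lt_trans _ alT)// ler_pM2l//.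
- by move=> t _; rewrite mulr_gt0// expR_gt0.
Qed.

End Existence.

(** * The explicit solutions of the differential equation *)

Section Prolongation.
Context {R : realType}.

(** An arbitrary prolongation is known only on [0, T]. This determines B' directly on ]0, T[; at T
    the equation follows by continuity of B and B'. *)
Lemma prolongation_ode (K gam al be T : R) (B : R -> R) :
  be * T < al -> 0 < be -> 0 < T ->
  prolongation T (fun t => K * (al - be * t) `^ gam) B ->
  forall t, 0 < t <= T -> gam * be * B t + (al - be * t) * B^`()%classic t = 0.
Proof.
move=> alT be0 T0 [[dB ddB _] BE _].
pose G t := gam * be * B t + (al - be * t) * B^`()%classic t.
have pos t : t <= T -> 0 < al - be * t.
  by move=> tT; rewrite subr_gt0 (le_lt_trans _ alT)// ler_pM2l.
have BE' t : 0 < t < T -> B t = K * expR (gam * ln (al - be * t)).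
  by move=> /andP[/ltW t0 /ltW tT]; rewrite BE ?t0// /powR gt_eqF// pos.
have G0 t : 0 < t < T -> G t = 0.
  move=> tT; have /andP[_ /ltW /pos p0] := tT.
  have ht : is_derive t (1 : R) (fun t : R => t) 1 by exact: is_derive_id.
  have hl := isD_add (isD_cst t (1 : R) al) (isD_opp (isD_mul (isD_cst t (1 : R) be) ht)).
  have hln := isD_comp_at (f := fun u => al - be * u) (is_derive1_ln p0) hl.
  have he := isD_mul (isD_cst t (1 : R) K)
    (isD_comp_at (is_derive_expR _) (isD_mul (isD_cst t (1 : R) gam) hln)).
  have near_eq : \near t, K * expR (gam * ln (al - be * t)) = B t.
    near=> u; rewrite BE'//; near: u.
    have /near_in_itvoo : t \in `]0, T[ by rewrite in_itv/= tT.
    by apply: filterS => u; rewrite in_itv.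
  have /is_derive1E hB := near_eq_is_derive near_eq he.
  rewrite /G hB BE'//; field; by rewrite gt_eqF.
move=> t /andP[t0]; rewrite le_eqVlt => /orP[/eqP ->|tT]; last by apply: G0; rewrite t0.
(* If G(T) <> 0, then G is nonzero on a ball around T, which contains points T - m of ]0, T[. *)
apply/eqP/negPn/negP => GT.
have cG : {for T, continuous G}.
  have cB : {for T, continuous B} by exact: continuous_derivable.
  have cB1 : {for T, continuous (B^`()%classic)} by exact: continuous_derivable.
  have hT : is_derive T (1 : R) (fun t : R => t) 1 by exact: is_derive_id.
  have [dl _] := isD_add (isD_cst T (1 : R) al) (isD_opp (isD_mul (isD_cst T (1 : R) be) hT)).
  have cl := continuous_derivable dl.
  have cg : {for T, continuous (fun _ : R => gam * be)} by exact: cst_continuous.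
  exact: continuousD (continuousM cg cB) (continuousM cl cB1).
have /nbhs_ballP[d /= d0 hd] : \forall t \near T, G t != 0 by exact: cvgr_neq0 cG GT.
pose m := Num.min d T / 2.
have md0 : 0 < Num.min d T by rewrite lt_min d0.
have m0 : 0 < m by rewrite divr_gt0.
have : m < Num.min d T by rewrite ltr_pdivrMr// ltr_pMr ?ltr1n.
rewrite lt_min => /andP[md mT].
have /hd : ball T d (T - m) by rewrite /ball/= opprB addrC subrK gtr0_norm.
by rewrite G0 ?eqxx// subr_gt0 mT ltrBlDr ltrDl.
Unshelve. all: by end_near. Qed.

Lemma expR_ode (K c : R) : let B := fun t : R => K * expR (c * t) in
  C2 B /\ forall t, B^`()%classic t = c * B t.
Proof.
move=> B.
have hB (t : R) : is_derive t (1 : R) B (c * B t).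
  have ht : is_derive t (1 : R) (fun t : R => t) 1 by exact: is_derive_id.
  have he := isD_mul (isD_cst t (1 : R) K)
    (isD_comp_at (is_derive_expR _) (isD_mul (isD_cst t (1 : R) c) ht)).
  by apply: (is_derive_eq he); rewrite /B; ring.
have hB2 (t : R) : is_derive t (1 : R) (fun t => c * B t) (c * (c * B t)).
  by apply: (is_derive_eq (isD_mul (isD_cst t (1 : R) c) (hB t))); ring.
split; last by move=> t; exact: is_derive1E.
apply: (C2_intro hB hB2) => t; apply: continuous_derivable.
by have [] := isD_mul (isD_cst t (1 : R) c) (hB2 t).
Qed.

End Prolongation.

(** * The classification and the explicit metrics *)

Section Conclusion.
Context {R : realType} {n : nat}.
Variable S : 'M[R]_n.+1.
Hypothesis symS : S^T = S.

Lemma harmonic_two_eigenvalues (B C : R -> R) : (2 <= n)%N ->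
  (exists p q : 'rV[R]_n.+1, [/\ dot p p = 1, dot q q = 1 & quad S p <> quad S q]) ->
  kaluza_klein n (cst 1) B C -> harmonic_section S (cst 1) B C ->
  [/\ odd n, exists a1 a2, two_eigenvalues S a1 a2 & (3 < n)%N].
Proof.
move=> n2 nc KK hS.
have [on [a [b hab]]] := trace_two_eigenvalues symS nc (ltnW n2) (trace_pair n2 KK symS hS).
split=> //; first by exists a, b.
have n3 : (3 <= n)%N by rewrite ltn_neqAle n2 andbT; apply: contraTneq on => <-.
rewrite ltn_neqAle n3 andbT; apply/eqP => n3E.
have [_ tr1 tr2 [p [q [pp qq pq pS qS]]]] := two_eigenvalues_quadratic symS on hab.
have [ba _ _ _] := hab.
have [_ [dB _ _] [dC _ _] _ _] := KK.
have B0 t : 0 <= t -> 0 < B t by move=> t0; have [] := kaluza_klein_gt0 n2 KK t0.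
have ab : a != b by rewrite gt_eqF.
apply: (radial_eq_dim3 (C := C) dB dC B0 ab) => l lT.
have := radial_pair KK symS hS pp qq pq pS qS lT.
by rewrite tr1 tr2 -n3E.
Qed.

(** For n = 5 the coefficient of B' is the constant 4T = (a-b)^2, and the equation reads 8 B +
    (a-b)^2 B' = 0. *)
Lemma harmonic_exponential (a b K : R) :
  two_eigenvalues S a b -> 0 < K -> n = 5%N ->
  let B := fun t : R => K * expR (- 8 * t / (a - b) ^+ 2) in
  kaluza_klein n (cst 1) B (cst 0) /\ harmonic_section S (cst 1) B (cst 0).
Proof.
move=> hab K0 n5 B; have on : odd n by rewrite n5.
have [ba _ _ _] := hab.
have ab : a - b != 0 by rewrite subr_eq0 gt_eqF.
have BE : B = fun t => K * expR (- 8 / (a - b) ^+ 2 * t).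
  by apply/funext => t; rewrite /B mulrAC.
have [cB B1] := expR_ode K (- 8 / (a - b) ^+ 2).
rewrite -BE in cB B1.
have B0 t : 0 <= t -> 0 < B t by move=> _; rewrite mulr_gt0// expR_gt0.
split; first exact: kaluza_klein_C0.
apply: (harmonic_section_two symS on hab cB B0) => t _.
have -> : B^`()%classic t = - 8 / (a - b) ^+ 2 * B t by rewrite B1 BE.
by rewrite n5; field.
Qed.

Lemma harmonic_power (a b K : R) :
  odd n -> two_eigenvalues S a b -> 0 < K -> (5 < n)%N ->
  let T := (a - b) ^+ 2 / 4 in
  let B0 := fun t : R => K * (((n%:R - 3) / 2 * (a - b) ^+ 2 - (n%:R - 5) * t)
               `^ ((n%:R + 3) / (n%:R - 5))) in
  (exists B : R -> R, prolongation T B0 B) /\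
  (forall B : R -> R, prolongation T B0 B ->
     kaluza_klein n (cst 1) B (cst 0) /\ harmonic_section S (cst 1) B (cst 0)).
Proof.
move=> on hab K0 n5 T B0; have [ba _ _ _] := hab.
have T0 : 0 < T by rewrite divr_gt0// exprn_gt0// subr_gt0.
have be0 : 0 < n%:R - 5 :> R by rewrite subr_gt0 (ltr_nat R 5).
(* In this form the base of the power is the coefficient of B' in the equation, and the exponent
   times n - 5 is n + 3. The base is still positive at T because n - 5 < 2(n - 3). *)
have alE : (n%:R - 3) / 2 * (a - b) ^+ 2 = 2 * (n%:R - 3) * T by rewrite /T; field.
have alT : (n%:R - 5) * T < (n%:R - 3) / 2 * (a - b) ^+ 2.
  by rewrite alE ltr_pM2r//; move: be0; lra.
split; first exact: prolongation_exists.
move=> B hB; have [cB _ Bpos] := hB.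
split; first exact: kaluza_klein_C0.
apply: (harmonic_section_two symS on hab cB Bpos) => t tT.
have := prolongation_ode alT be0 T0 hB tT.
by rewrite divfK ?gt_eqF// alE.
Qed.

End Conclusion.

Theorem proposition6p2 (R : realType) (n : nat) (hn : (2 <= n)%N)
    (S : 'M[R]_n.+1) (hS : S^T = S)
    (hnonconst : exists p q : 'rV[R]_n.+1,
        [/\ dot p p = 1, dot q q = 1 & quad S p <> quad S q]) :
  (~~ odd n ->
    ~ exists B C : R -> R,
        kaluza_klein n (cst 1) B C /\ harmonic_section S (cst 1) B C)
  /\
  (odd n ->
    ((exists B C : R -> R,
        kaluza_klein n (cst 1) B C /\ harmonic_section S (cst 1) B C)
     <->
     ((exists a1 a2 : R, two_eigenvalues S a1 a2) /\ (3 < n)%N))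
    /\
    (forall a1 a2 : R, two_eigenvalues S a1 a2 -> (3 < n)%N ->
      let mu := a1 - a2 in
      forall K : R, 0 < K ->
      (n = 5%N ->
        let B := fun t : R => K * expR (- 8 * t / mu ^+ 2) in
        kaluza_klein n (cst 1) B (cst 0)
        /\ harmonic_section S (cst 1) B (cst 0))
      /\
      ((5 < n)%N ->
        let B0 := fun t : R =>
          K * (((n%:R - 3) / 2 * mu ^+ 2 - (n%:R - 5) * t)
               `^ ((n%:R + 3) / (n%:R - 5))) in
        (exists B : R -> R, prolongation (mu ^+ 2 / 4) B0 B)
        /\
        (forall B : R -> R, prolongation (mu ^+ 2 / 4) B0 B ->
          kaluza_klein n (cst 1) B (cst 0)
          /\ harmonic_section S (cst 1) B (cst 0))))).
Proof.
have gen B C : kaluza_klein n (cst 1) B C -> harmonic_section S (cst 1) B C ->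
    [/\ odd n, exists a1 a2, two_eigenvalues S a1 a2 & (3 < n)%N].
  exact: harmonic_two_eigenvalues.
split=> [en [B [C [KK hm]]]|on]; first by have [on] := gen B C KK hm; rewrite on in en.
split=> [|a1 a2 hab n3 mu K K0].
  split=> [[B [C [KK hm]]]|[[a [b hab]] n3]]; first by have [] := gen B C KK hm.
  have [n5|n5] := eqVneq n 5%N.
    have [KK hm] := harmonic_exponential hS hab ltr01 n5.
    by do 2![eexists]; split; [exact: KK | exact: hm].
  have n6 : (5 < n)%N.
    by move: n3 n5 on; case: (n) => [|[|[|[|[|[|k]]]]]].
  have [[B hB] h] := harmonic_power hS on hab ltr01 n6.
  by exists B, (cst 0); exact: h.
split=> [n5|n5]; first exact: harmonic_exponential.
exact: harmonic_power.
Qed.
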